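(* Let $p$ and $q$ be relatively prime integers with $|p|\neq|q|$, and let $\Gamma=\langle a,b \mid a b^{p} a^{-1} = b^{q}\rangle$ be the corresponding Baumslag--Solitar group. Let $G$ be the group of complex points of a reductive algebraic group and let $K<G$ be a maximal compact subgroup. Then there is a strong deformation retraction of $\mathrm{Hom}(\Gamma,G)$ onto $\mathrm{Hom}(\Gamma,K)$. In particular, the two spaces are homotopy equivalent.
   Context: A complex linear algebraic group $G$ (a Zariski closed subgroup of some $\mathrm{SL}_n(\mathbb{C})$, not necessarily connected) is called reductive if it is the complexification of a compact Lie group; it carries its Lie group (Euclidean) topology. The set $\mathrm{Hom}(\Gamma,G)$ of group homomorphisms is identified, via $\rho\mapsto(\rho(a),\rho(b))$, with the closed subset $\{(x,y)\in G\times G : x y^{p} x^{-1}=y^{q}\}$ of $G\times G$ and is given the subspace topology; $\mathrm{Hom}(\Gamma,K)$ is the subspace of homomorphisms with image in $K$. *)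

(* Defs.v *)
From HB Require Import structures.
From mathcomp Require Import all_boot all_order all_algebra.
From mathcomp Require Import all_classical all_reals all_analysis.
From mathcomp Require Import complex.
From mathcomp Require mpoly.
Import Order.TTheory GRing.Theory Num.Theory.
Import numFieldNormedType.Exports.

Set Implicit Arguments.
Unset Strict Implicit.
Unset Printing Implicit Defensive.

Local Open Scope classical_set_scope.
Local Open Scope ring_scope.
Local Open Scope quotient_scope.

Section Presentation.
Variable X : choiceType.

(* The letter (x, false) stands for the generator x, (x, true) for x^-1. *)
Definition word := seq (X * bool).

Definition wpow (x : X) (z : int) : word :=
  match z with
  | Posz k => nseq k (x, false)
  | Negz k => nseq k.+1 (x, true)
  end.

Definition winv (w : word) : word := rev [seq (l.1, ~~ l.2) | l <- w].

Variable rels : set (word * word).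

(* The least congruence on words that cancels x x^-1 and x^-1 x and
   identifies the two sides of every relation. *)
Inductive pres_eq : word -> word -> Prop :=
| pres_refl u : pres_eq u u
| pres_sym u v : pres_eq u v -> pres_eq v u
| pres_trans v u w : pres_eq u v -> pres_eq v w -> pres_eq u w
| pres_cancel u v l : pres_eq (u ++ [:: l; (l.1, ~~ l.2)] ++ v) (u ++ v)
| pres_rel u v s t : rels (s, t) -> pres_eq (u ++ s ++ v) (u ++ t ++ v).

Definition pres_eqb (u v : word) : bool := `[< pres_eq u v >].

Lemma pres_eqb_equiv : equiv_class_of pres_eqb.
Proof.
split=> [u|u v|v u w]; first exact/asboolP/pres_refl.
  by apply/asboolP/asboolP => ?; exact: pres_sym.
by move=> /asboolP uv /asboolP vw; exact/asboolP/(pres_trans uv).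
Qed.

Canonical pres_equiv := EquivRelPack pres_eqb_equiv.

Definition presented : Type := {eq_quot pres_equiv}.

HB.instance Definition _ := Choice.on presented.
HB.instance Definition _ := EqQuotient.on presented.

Definition pres_class (w : word) : presented := \pi_presented w.

Lemma pres_classP u v : (pres_class u = pres_class v) <-> pres_eq u v.
Proof.
split=> [/eqmodP/asboolP //|uv].
by apply/eqmodP/asboolP.
Qed.

Lemma pres_reprK (a : presented) : pres_class (repr a) = a.
Proof. exact: reprK. Qed.

Lemma pres_repr w : pres_eq (repr (pres_class w)) w.
Proof. by apply/pres_classP; rewrite pres_reprK. Qed.

Lemma pres_catl w u v : pres_eq u v -> pres_eq (w ++ u) (w ++ v).
Proof.
elim=> {u v} [u|u v _|v u t _ uv _|u v l|u v s t st].
- exact: pres_refl.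
- exact: pres_sym.
- exact: pres_trans.
- by rewrite !(catA w); exact: pres_cancel.
- by rewrite !(catA w); exact: pres_rel.
Qed.

Lemma pres_catr w u v : pres_eq u v -> pres_eq (u ++ w) (v ++ w).
Proof.
elim=> {u v} [u|u v _|v u t _ uv _|u v l|u v s t st].
- exact: pres_refl.
- exact: pres_sym.
- exact: pres_trans.
- by rewrite -!catA; exact: pres_cancel.
- by rewrite -!catA; exact: pres_rel.
Qed.

Lemma pres_cat u u' v v' :
  pres_eq u u' -> pres_eq v v' -> pres_eq (u ++ v) (u' ++ v').
Proof. by move=> uu' vv'; apply: pres_trans (pres_catr _ uu') (pres_catl _ vv'). Qed.

Lemma winv_cons l w : winv (l :: w) = winv w ++ [:: (l.1, ~~ l.2)].
Proof. by rewrite /winv /= rev_cons cats1. Qed.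

Lemma winvK : involutive winv.
Proof.
move=> w; rewrite /winv map_rev revK -map_comp -[RHS]map_id.
by apply: eq_map => -[x e] /=; rewrite negbK.
Qed.

Lemma pres_mulV w : pres_eq (w ++ winv w) [::].
Proof.
elim: w => [|l w IHw]; first exact: pres_refl.
rewrite winv_cons catA; apply: (pres_trans (v := [:: l] ++ [:: (l.1, ~~ l.2)])).
  by rewrite -cat1s -!catA; apply: pres_catl; rewrite catA; exact: (pres_catr _ IHw).
exact: (pres_cancel [::] [::] l).
Qed.

Definition pres_mul (a b : presented) := pres_class (repr a ++ repr b).
Definition pres_one := pres_class [::].
Definition pres_inv (a : presented) := pres_class (winv (repr a)).

Lemma pres_mul_class u v :
  pres_mul (pres_class u) (pres_class v) = pres_class (u ++ v).
Proof. by apply/pres_classP; apply: pres_cat; exact: pres_repr. Qed.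

Lemma pres_mulA : associative pres_mul.
Proof.
move=> a b c; rewrite -[a]pres_reprK -[b]pres_reprK -[c]pres_reprK.
by rewrite !pres_mul_class catA.
Qed.

Lemma pres_mul1g : left_id pres_one pres_mul.
Proof. by move=> a; rewrite -[a]pres_reprK pres_mul_class. Qed.

Lemma pres_mulg1 : right_id pres_one pres_mul.
Proof. by move=> a; rewrite -[a]pres_reprK pres_mul_class cats0. Qed.

Lemma pres_mulgV : right_inverse pres_one pres_inv pres_mul.
Proof.
move=> a; rewrite -{1}[a]pres_reprK pres_mul_class.
by apply/pres_classP; exact: pres_mulV.
Qed.

Lemma pres_mulVg : left_inverse pres_one pres_inv pres_mul.
Proof.
move=> a; rewrite -{2}[a]pres_reprK pres_mul_class.
apply/pres_classP; rewrite -{2}[repr a]winvK; exact: pres_mulV.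
Qed.

HB.instance Definition _ := isGroup.Build presented
  pres_mulA pres_mul1g pres_mulg1 pres_mulVg pres_mulgV.

Definition pres_gen (x : X) : presented := pres_class [:: (x, false)].

End Presentation.

(* The generator a is [false], the generator b is [true]. *)
Definition BS_rels (p q : int) : set (word bool * word bool) :=
  [set ((false, false) :: wpow true p ++ [:: (false, true)], wpow true q)].

Definition BS (p q : int) : groupType := presented (BS_rels p q).
Definition BS_a (p q : int) : BS p q := pres_gen (BS_rels p q) false.
Definition BS_b (p q : int) : BS p q := pres_gen (BS_rels p q) true.

(* R[i] has no topology of its own; seen as a numClosedFieldType it gets the
   one of its modulus, and matrices over it the entrywise topology. *)
Definition Cplx (R : realType) : numClosedFieldType := R[i]%C.

Section Groups.
Variable R : realType.
Local Notation C := (Cplx R).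

Definition matrix_group n (G : set 'M[C]_n) : Prop :=
  [/\ G `<=` [set A | A \in unitmx],
      G 1%:M,
      (forall A B, G A -> G B -> G (A *m B)) &
      (forall A, G A -> G (invmx A))].

Definition peval n (f : mpoly.mpoly (n * n) C) (A : 'M[C]_n) : C :=
  mpoly.meval (fun k => mxvec A 0 k) f.

Definition zariski_closed_in_SL n (G : set 'M[C]_n) : Prop :=
  exists I : set (mpoly.mpoly (n * n) C),
    G = [set A | \det A = 1 /\ forall f, I f -> peval f A = 0].

Definition linear_algebraic_group n (G : set 'M[C]_n) : Prop :=
  matrix_group G /\ zariski_closed_in_SL G.

Definition compact_group n (K : set 'M[C]_n) : Prop :=
  matrix_group K /\ compact K.

Definition maximal_compact_subgroup n (G K : set 'M[C]_n) : Prop :=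
  [/\ compact_group K, K `<=` G &
      forall K', compact_group K' -> K' `<=` G -> K `<=` K' -> K' = K].

(* Continuous functions on L whose translates span a finite-dimensional space. *)
Definition representative_function d (L : set 'M[C]_d) (h : 'M[C]_d -> C) :
    Prop :=
  {within L, continuous h} /\
  exists (m : nat) (e c : 'I_m -> 'M[C]_d -> C),
    forall x y, L x -> L y -> h (x *m y) = \sum_i c i y * e i x.

(* Chevalley's definition: the complexification of a compact Lie group L is the
   complex algebraic group whose coordinate ring is the ring of complex
   representative functions on L. As G is closed in SL_n, its regular functions
   are the restrictions of polynomials in the matrix entries. *)
Definition complexification d (L : set 'M[C]_d) n (G : set 'M[C]_n) : Prop :=
  exists phi : 'M[C]_d -> 'M[C]_n,
    [/\ {within L, continuous phi} /\ (forall x, L x -> G (phi x)),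
        forall x y, L x -> L y -> phi (x *m y) = phi x *m phi y,
        forall f, (forall x, L x -> peval f (phi x) = 0) ->
                  forall A, G A -> peval f A = 0 &
        forall h, representative_function L h ->
                  exists f, forall x, L x -> h x = peval f (phi x)].

(* By the Peter-Weyl theorem the compact Lie groups are, up to isomorphism, the
   compact subgroups of the groups GL_d(C). *)
Definition reductive n (G : set 'M[C]_n) : Prop :=
  linear_algebraic_group G /\
  exists (d : nat) (L : set 'M[C]_d), compact_group L /\ complexification L G.

Definition is_hom (Gam : groupType) n (G : set 'M[C]_n) (rho : Gam -> 'M[C]_n) :
    Prop :=
  (forall u, G (rho u)) /\ (forall u v, rho (u * v)%g = rho u *m rho v).

(* Hom(BS p q, G), identified through rho |-> (rho a, rho b) with a subset of the
   space of pairs of matrices, from which it takes its topology. *)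
Definition Hom_BS (p q : int) n (G : set 'M[C]_n) :
    set ('M[C]_n * 'M[C]_n)%type :=
  [set (rho (BS_a p q), rho (BS_b p q)) | rho in @is_hom (BS p q) n G].

Definition mxpowz n (A : 'M[C]_n) (z : int) : 'M[C]_n :=
  match z with
  | Posz k => A ^+ k
  | Negz k => invmx (A ^+ k.+1)
  end.

Section HomBS.
Variables (n : nat) (G : set 'M[C]_n).
Hypothesis Ggrp : matrix_group G.

Let Gunit A : G A -> A \in unitmx. Proof. by case: Ggrp => + _ _ _ => /[apply]. Qed.

Let mulmxI (A B D : 'M[C]_n) : G A -> A *m B = A *m D -> B = D.
Proof. by move=> /Gunit uA AB; rewrite -[B](mulKmx uA) AB mulKmx. Qed.

Let wmap (g : bool -> 'M[C]_n) (l : bool * bool) :=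
  if l.2 then invmx (g l.1) else g l.1.

Let wval (g : bool -> 'M[C]_n) (w : word bool) : 'M[C]_n :=
  foldr (fun l A => wmap g l *m A) 1%:M w.

Let wval_cat g u v : wval g (u ++ v) = wval g u *m wval g v.
Proof. by elim: u => [|l u IHu] /=; rewrite ?mul1mx // IHu mulmxA. Qed.

Let unitmxX (A : 'M[C]_n) k : A \in unitmx -> A ^+ k \in unitmx.
Proof.
move=> uA; elim: k => [|k IHk]; first exact: unitmx1.
by rewrite exprS [_ \in _]unitmx_mul uA.
Qed.

Let wval_pow g x z : g x \in unitmx -> wval g (wpow x z) = mxpowz (g x) z.
Proof.
move=> ux; case: z => k /=.
  by elim: k => //= k ->; rewrite exprS.
suff H m : wval g (nseq m (x, true)) *m (g x) ^+ m = 1%:M.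
  rewrite -/(nseq k.+1 _) -[LHS](mulmxK (unitmxX k.+1 ux)).
  by have := H k.+1 => /= ->; rewrite mul1mx.
elim: m => [|m IHm]; first exact: mul1mx.
rewrite -[m.+1]addn1 nseqD wval_cat addnC exprS -mulmxA.
by rewrite /= mulmx1 /wmap /= mulKmx.
Qed.

Let hom_wval (p q : int) (rho : BS p q -> 'M[C]_n) : is_hom G rho ->
  forall w, rho (pres_class (BS_rels p q) w) =
            wval (fun x => rho (pres_gen (BS_rels p q) x)) w.
Proof.
move=> [Grho rhoM].
have rho1 : rho 1%g = 1%:M.
  by apply: (mulmxI (Grho 1%g)); rewrite -rhoM mulg1 mulmx1.
have rhoV u : rho u^-1%g = invmx (rho u).
  by apply: (mulmxI (Grho u)); rewrite -rhoM mulgV rho1 mulmxV // Gunit.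
elim=> [|[x e] w IHw]; first exact: rho1.
rewrite -cat1s -pres_mul_class [LHS]rhoM IHw /=; congr (_ *m _).
case: e => //; rewrite /wmap /= -rhoV; congr (rho _).
apply/esym/(mulg1_eq (x := pres_gen _ x)).
rewrite [LHS]pres_mul_class; apply/pres_classP.
exact: (pres_cancel _ [::] [::] (x, false)).
Qed.

Lemma Hom_BSE (p q : int) :
  Hom_BS p q G = [set xy | [/\ G xy.1, G xy.2 &
    xy.1 *m mxpowz xy.2 p *m invmx xy.1 = mxpowz xy.2 q]].
Proof.
apply/seteqP; split=> [_ [rho rho_hom <-]|[x y] [/= Gx Gy xy]].
  have [Grho _] := rho_hom; split=> //=.
  have : pres_class (BS_rels p q)
      ((false, false) :: wpow true p ++ [:: (false, true)]) =
      pres_class (BS_rels p q) (wpow true q).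
    apply/pres_classP.
    have := @pres_rel _ (BS_rels p q) [::] [::] _ _ (erefl _).
    by rewrite /= !cats0.
  move=> /(congr1 rho); set r := BS_rels p q.
  rewrite (hom_wval rho_hom (_ :: _)) (hom_wval rho_hom (wpow true q)) /=.
  rewrite wval_cat !wval_pow ?Gunit //.
  by rewrite /= mulmx1 /wmap /= mulmxA.
pose g b := if b then y else x.
have Gg b : G (g b) by case: b.
have ug b : g b \in unitmx by exact: Gunit.
have [_ G1 GM GV] := Ggrp.
have Gwval w : G (wval g w).
  by elim: w => //= -[b e] w IHw; apply: GM => //; rewrite /wmap; case: e; rewrite //=; exact: GV.
have wvalP u v : pres_eq (BS_rels p q) u v -> wval g u = wval g v.
  elim=> {u v} [//|u v _ -> //|v u t _ -> _ -> //|u v [b e]|u v s t [-> ->]].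
    rewrite !wval_cat /= mulmx1 [wmap _ _ *m _ *m _](_ : _ = wval g v) //.
    by case: e; rewrite /wmap /= ?mulVmx ?mulmxV // mul1mx.
  rewrite (wval_cat g u) (wval_cat g u) (wval_cat g _ v) (wval_cat g _ v).
  congr (_ *m (_ *m _)).
  rewrite -[_ :: _]/([:: _] ++ _) (wval_cat g [:: _]) (wval_cat g (wpow _ _)).
  by rewrite !wval_pow ?ug //= !mulmx1 /wmap /= mulmxA.
exists (fun a => wval g (repr a)).
  split=> [a|a b]; first exact: Gwval.
  by rewrite -wval_cat; apply: wvalP; exact: pres_repr.
by congr pair; rewrite (wvalP _ _ (pres_repr _ _)) /= mulmx1.
Qed.

End HomBS.

End Groups.

Section Homotopy.
Variable R : realType.

Definition strong_deformation_retraction (T : topologicalType) (X A : set T)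
    (H : R * T -> T) : Prop :=
  A `<=` X /\ {within `[0, 1]%classic `*` X, continuous H} /\
  [/\ forall t x, `[0, 1]%classic t -> X x -> X (H (t, x)),
      forall x, X x -> H (0, x) = x,
      forall x, X x -> A (H (1, x)) &
      forall t a, `[0, 1]%classic t -> A a -> H (t, a) = a].

Definition homotopic (S T : topologicalType) (X : set S) (Y : set T)
    (f g : S -> T) : Prop :=
  exists H : R * S -> T,
    [/\ {within `[0, 1]%classic `*` X, continuous H},
        forall t x, `[0, 1]%classic t -> X x -> Y (H (t, x)),
        forall x, X x -> H (0, x) = f x &
        forall x, X x -> H (1, x) = g x].

Definition homotopy_equivalent (S T : topologicalType) (X : set S) (Y : set T) :
    Prop :=
  exists (f : S -> T) (g : T -> S),
    [/\ {within X, continuous f} /\ (forall x, X x -> Y (f x)),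
        {within Y, continuous g} /\ (forall y, Y y -> X (g y)),
        homotopic X X (g \o f) id &
        homotopic Y Y (f \o g) id].

End Homotopy.

(* Main.v *)
(* If [x y^p x^-1 = y^q] then [x] permutes the eigenvalues of [y] up to taking
   powers, so they are roots of unity of bounded order [M] and [z = y^M] is
   unipotent.  As [z^t] is a polynomial in [t] and [z], the path [y z^(-t/M)]
   stays in the Zariski closed group [G] and deforms [y] into an element [s] of
   order dividing [M], where [M] is prime to [p].  A compact subgroup of [G] is
   Zariski dense, so after a conjugation [G] is stable under the conjugate
   transpose, and it contains the real powers of its positive definite elements.
   The function [Q |-> sum_j tr((s^j)^* Q s^j)] is strictly convex along the
   geodesics of these elements; its unique minimum [Q(s)] satisfies
   [s^* Q s = Q] and depends continuously on [s], so conjugating the pair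
   [(x, s)] by [Q(s)^(t/2)] makes [s] unitary.  Finally, for unitary [s] the
   matrix [x^* x] commutes with [s], so that [x (x^* x)^(-t/2)] deforms [x] into
   a unitary matrix.  The same convexity argument, with a supremum over a compact
   group instead of a finite sum, shows that every maximal compact subgroup is
   conjugate to the group of unitary elements of [G]. *)
Require Import Defs.
From HB Require Import structures.
From mathcomp Require Import all_boot all_order all_algebra.
From mathcomp Require Import fingroup perm cyclic spectral.
From mathcomp Require Import all_classical all_reals all_analysis.
From mathcomp Require Import complex lra.
From mathcomp Require mpoly.
Import (canonicals) mpoly.
Import Order.TTheory GRing.Theory Num.Theory.
Import numFieldNormedType.Exports.
Local Open Scope classical_set_scope.
Local Open Scope ring_scope.
Local Open Scope sesquilinear_scope.
Set Implicit Arguments.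
Unset Strict Implicit.
Unset Printing Implicit Defensive.

(** Reductivity enters through a Zariski dense compact subgroup of [G], the image of the compact
    group that is complexified. That a curve stays in [G], or that two curves agree, is always
    proved in the same way: the entries lie in an algebra of functions (polynomials or exponential
    sums) whose members vanish once they vanish at the natural numbers, and at natural times the
    claim is plain group theory. The order of the three deformations matters. Once [s ^+ M = 1], an
    energy with a fixed finite number of terms is invariant under [s], which makes its minimum
    depend continuously on [s]; and [s] has to be unitary before adjoints can be taken in the
    relation. Diagonalizations and minima are chosen, not given by formulas. Their continuity comes
    from compactness: the chosen data stay locally in a compact set, satisfy a closed condition, and
    this condition determines the result. The constant is [M = |p^(2 n!) - q^(2 n!)|]: the squares
    come from replacing [x] by [x^2], the factorial from the permutations of [n] eigenvalues. *)

Lemma eps_delta_continuous (K L : numFieldType) (f : K -> L) :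
  (forall a e, 0 < e ->
    exists2 d, 0 < d & forall b, `|a - b| < d -> `|f a - f b| < e) ->
  continuous f.
Proof.
move=> fP a U /= /(nbhs_ballP (f a))[e e0 sU]; have [d d0 dP] := fP a e e0.
by apply/nbhs_ballP; exists d => // b ab; apply: sU; exact: dP.
Qed.

(* An abstract copy of the complex numbers over [R]: on the concrete field
   [Cplx R] unification of unequal matrix expressions diverges. *)
Record complexOver (R : realType) := ComplexOver {
  cplx :> numClosedFieldType;
  ofR : R -> cplx;
  ofR_zmod_morphism : zmod_morphism ofR;
  ofR_monoid_morphism : monoid_morphism ofR;
  ler_ofR : {mono ofR : a b / a <= b};
  ofR_real : forall z : cplx, z \is Num.real -> exists a, z = ofR a }.
Arguments ofR {R c}.

HB.instance Definition _ (R : realType) (C : complexOver R) :=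
  GRing.isZmodMorphism.Build R C (@ofR R C) (@ofR_zmod_morphism R C).
HB.instance Definition _ (R : realType) (C : complexOver R) :=
  GRing.isMonoidMorphism.Build R C (@ofR R C) (@ofR_monoid_morphism R C).

(** * Topology of the complex numbers over [R] *)

Section ComplexTopology.
Variables (R : realType) (C : complexOver R).
Implicit Types (a b : R) (z w : C).

(** The real part as an element of [R]. [ofR_real] only asserts existence, hence [xget]; injectivity
    of [ofR] makes the value unique. *)
Definition Rep z : R := xget 0 [set a | 'Re z = ofR a].

Lemma ofR_Rep z : ofR (Rep z) = 'Re z.
Proof.
by rewrite /Rep; case: xgetP => // H; have [a /H] := ofR_real (Creal_Re z).
Qed.

Lemma ofR_inj : injective (@ofR R C).
Proof. exact: fmorph_inj. Qed.

Lemma real_ofR a : (ofR a : C) \is Num.real.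
Proof. by rewrite realE -(rmorph0 (@ofR R C)) !ler_ofR le_total. Qed.

Lemma ofRK a : Rep (ofR a) = a.
Proof. by apply: ofR_inj; rewrite ofR_Rep (Creal_ReP _ (real_ofR a)). Qed.

Lemma Rep_is_zmod : zmod_morphism Rep.
Proof. by move=> z w; apply: ofR_inj; rewrite rmorphB /= !ofR_Rep raddfB. Qed.
HB.instance Definition _ := GRing.isZmodMorphism.Build C R Rep Rep_is_zmod.

Lemma ltr_ofR a b : (ofR a < ofR b :> C) = (a < b).
Proof. by rewrite !lt_neqAle ler_ofR (inj_eq ofR_inj). Qed.

Lemma ofR_ge0 a : (0 <= ofR a :> C) = (0 <= a).
Proof. by rewrite -(rmorph0 (@ofR R C)) ler_ofR. Qed.

Lemma ge0_ofR z : 0 <= z -> z = ofR (Rep z).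
Proof. by move=> /ger0_real /Creal_ReP; rewrite ofR_Rep. Qed.

Lemma Rep_ge0 z : 0 <= z -> 0 <= Rep z.
Proof. by move=> z0; rewrite -(@ler_ofR _ C) rmorph0 -ge0_ofR. Qed.

Lemma Rep_lt z : 0 < z -> 0 < Rep z.
Proof. by move=> z0; rewrite -ltr_ofR rmorph0 -ge0_ofR // ltW. Qed.

Lemma norm_ofR a : `|ofR a : C| = ofR `|a|.
Proof.
have [a0|a0] := ger0P a; first by rewrite ger0_norm // -(rmorph0 (@ofR R C)) ler_ofR.
by rewrite ltr0_norm ?rmorphN // -(rmorph0 (@ofR R C)) ltr_ofR.
Qed.

Lemma norm_Rep z : ofR `|Rep z| <= `|z|.
Proof. by rewrite -norm_ofR ofR_Rep; by case: (leif_normC_Re_Creal z). Qed.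

Lemma conj_ofR a : (ofR a : C)^* = ofR a.
Proof. exact/CrealP/real_ofR. Qed.

Lemma ofR_continuous : continuous (@ofR R C).
Proof.
(* Radii in [C] are positive elements of [C], hence real, and [Rep] turns them into radii in [R]. *)
apply: eps_delta_continuous => a e e0; exists (Rep e); first exact: Rep_lt e0.
by move=> b ab; rewrite -rmorphB norm_ofR (ge0_ofR (ltW e0)) ltr_ofR.
Qed.

Lemma Rep_continuous : continuous Rep.
Proof.
apply: eps_delta_continuous => a e e0; exists (ofR e).
  by rewrite -(rmorph0 (@ofR R C)) ltr_ofR.
move=> b ab; rewrite -raddfB -ltr_ofR; exact: le_lt_trans (norm_Rep _) _.
Qed.

Lemma conjC_continuous : continuous (fun z : C => z^*).
Proof.
apply: eps_delta_continuous => a e e0; exists e => // b.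
by rewrite -rmorphB norm_conjC.
Qed.

(** The norm takes values in [C], so the nonnegative elements are the zeros of the continuous
    function [|z| - z]. *)
Lemma closed_ge0C : closed [set z : C | 0 <= z].
Proof.
have nc : continuous (fun z : C => `|z| : C).
  apply: eps_delta_continuous => a e e0.
  by exists e => // b; apply: le_lt_trans; exact: ler_dist_dist.
have -> : [set z : C | 0 <= z] = (fun z : C => `|z| - z) @^-1` [set 0].
  apply/seteqP; split=> z /=; first by move=> z0; rewrite ger0_norm // subrr.
  by move/eqP; rewrite subr_eq0 => /eqP <-.
apply: closed_comp => [z _|]; last first.
  exact: (accessible_closed_set1 (hausdorff_accessible (@norm_hausdorff _ C))).
exact: (@cvgB _ _ _ (nbhs z) _ _ _ _ _ (nc z) (@cvg_id _ (nbhs z))).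
Qed.

End ComplexTopology.

(** * Entrywise limits of matrix operations *)

Section MatrixTopology.
Variable K : numFieldType.

Lemma cvg_mx T (F : set_system T) {FF : Filter F} m n
  (f : T -> 'M[K]_(m, n)) (A : 'M[K]_(m, n)) :
  (forall i j, f x i j @[x --> F] --> A i j) -> f @ F --> A.
Proof.
move=> fA U [P AP sPU].
have : \forall x \near F, forall i j, P i j (f x i j).
  by apply: filter_forall => i; apply: filter_forall => j; exact: fA.
by apply: filterS => x Px; exact: sPU.
Qed.

Lemma cvg_mx_coord T (F : set_system T) {FF : Filter F} m n
  (f : T -> 'M[K]_(m, n)) (A : 'M[K]_(m, n)) i j :
  f @ F --> A -> f x i j @[x --> F] --> A i j.
Proof.
move=> fA; apply: (@continuous_cvg _ _ _ F _ f (fun M : 'M[K]_(m, n) => M i j)).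
  exact: coord_continuous.
exact: fA.
Qed.

Lemma cvg_sumr T (F : set_system T) {FF : Filter F} (I : Type) (r : seq I)
  (P : pred I) (f : I -> T -> K) (a : I -> K) :
  (forall i, f i @ F --> a i) ->
  \sum_(i <- r | P i) f i x @[x --> F] --> \sum_(i <- r | P i) a i.
Proof.
move=> fa; elim: r => [|i r IHr].
  by rewrite big_nil (_ : (fun _ => _) = cst 0) ?funeqE => [|x];
    [exact: cvg_cst|rewrite big_nil].
rewrite big_cons; case: ifPn => Pi.
  rewrite [X in X @ F](_ : _ = f i \+ (fun x => \sum_(j <- r | P j) f j x)).
    exact: cvgD.
  by apply/funext => x; rewrite big_cons Pi.
rewrite [X in X @ F](_ : _ = (fun x => \sum_(j <- r | P j) f j x)) //.
by apply/funext => x; rewrite big_cons (negPf Pi).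
Qed.

Lemma cvg_prodr T (F : set_system T) {FF : Filter F} (I : Type) (r : seq I)
  (P : pred I) (f : I -> T -> K) (a : I -> K) :
  (forall i, f i @ F --> a i) ->
  \prod_(i <- r | P i) f i x @[x --> F] --> \prod_(i <- r | P i) a i.
Proof.
move=> fa; elim: r => [|i r IHr].
  by rewrite big_nil (_ : (fun _ => _) = cst 1) ?funeqE => [|x];
    [exact: cvg_cst|rewrite big_nil].
rewrite big_cons; case: ifPn => Pi.
  rewrite [X in X @ F](_ : _ = f i \* (fun x => \prod_(j <- r | P j) f j x)).
    exact: cvgM.
  by apply/funext => x; rewrite big_cons Pi.
rewrite [X in X @ F](_ : _ = (fun x => \prod_(j <- r | P j) f j x)) //.
by apply/funext => x; rewrite big_cons (negPf Pi).
Qed.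

Lemma cvg_mulmx T (F : set_system T) {FF : Filter F} m n p
  (f : T -> 'M[K]_(m, n)) (g : T -> 'M[K]_(n, p)) (A : 'M[K]_(m, n)) (B : 'M[K]_(n, p)) :
  f @ F --> A -> g @ F --> B -> f x *m g x @[x --> F] --> A *m B.
Proof.
move=> fA gB; apply: cvg_mx => i j; rewrite mxE.
under eq_fun do rewrite mxE.
by apply: cvg_sumr => k; apply: cvgM; exact: cvg_mx_coord.
Qed.

Lemma cvg_addmx T (F : set_system T) {FF : Filter F} m n
  (f g : T -> 'M[K]_(m, n)) (A B : 'M[K]_(m, n)) :
  f @ F --> A -> g @ F --> B -> f x + g x @[x --> F] --> A + B.
Proof.
move=> fA gB; apply: cvg_mx => i j; rewrite mxE.
under eq_fun do rewrite mxE.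
by apply: cvgD; exact: cvg_mx_coord.
Qed.

Lemma cvg_scalemx T (F : set_system T) {FF : Filter F} m n
  (c : T -> K) (f : T -> 'M[K]_(m, n)) (a : K) (A : 'M[K]_(m, n)) :
  c @ F --> a -> f @ F --> A -> c x *: f x @[x --> F] --> a *: A.
Proof.
move=> ca fA; apply: cvg_mx => i j; rewrite mxE.
under eq_fun do rewrite mxE.
by apply: cvgM => //; exact: cvg_mx_coord.
Qed.

Lemma cvg_oppmx T (F : set_system T) {FF : Filter F} m n
  (f : T -> 'M[K]_(m, n)) (A : 'M[K]_(m, n)) :
  f @ F --> A -> - f x @[x --> F] --> - A.
Proof.
move=> fA; apply: cvg_mx => i j; rewrite mxE.
under eq_fun do rewrite mxE.
by apply: cvgN; exact: cvg_mx_coord.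
Qed.

Lemma cvg_summx T (F : set_system T) {FF : Filter F} m n (I : Type) (r : seq I)
  (P : pred I) (f : I -> T -> 'M[K]_(m, n)) (A : I -> 'M[K]_(m, n)) :
  (forall i, f i @ F --> A i) ->
  \sum_(i <- r | P i) f i x @[x --> F] --> \sum_(i <- r | P i) A i.
Proof.
move=> fA; apply: cvg_mx => i j; rewrite summxE.
under eq_fun do rewrite summxE.
by apply: cvg_sumr => k; exact: cvg_mx_coord.
Qed.

Lemma cvg_expmx T (F : set_system T) {FF : Filter F} n
  (f : T -> 'M[K]_n) (A : 'M[K]_n) k :
  f @ F --> A -> f x ^+ k @[x --> F] --> A ^+ k.
Proof.
move=> fA; elim: k => [|k IHk]; first exact: cvg_cst.
by under eq_fun do rewrite exprS; rewrite exprS; exact: cvg_mulmx.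
Qed.

Lemma cvg_det T (F : set_system T) {FF : Filter F} n (f : T -> 'M[K]_n) (A : 'M[K]_n) :
  f @ F --> A -> \det (f x) @[x --> F] --> \det A.
Proof.
move=> fA; apply: cvg_sumr => s; apply: cvgM; first exact: cvg_cst.
by apply: cvg_prodr => i; exact: cvg_mx_coord.
Qed.

Lemma cvg_mxtrace T (F : set_system T) {FF : Filter F} n (f : T -> 'M[K]_n) (A : 'M[K]_n) :
  f @ F --> A -> \tr (f x) @[x --> F] --> \tr A.
Proof. by move=> fA; apply: cvg_sumr => i; exact: cvg_mx_coord. Qed.

Lemma closed_eq0 (T : topologicalType) (f : T -> K) :
  continuous f -> closed [set x | f x = 0].
Proof.
move=> cf; apply: (@closed_comp _ _ f [set 0]) => [x _|]; first exact: cf.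
exact: (accessible_closed_set1 (hausdorff_accessible (@norm_hausdorff _ K))).
Qed.

Lemma closed_eqmx (T : topologicalType) m n (f g : T -> 'M[K]_(m, n)) :
  continuous f -> continuous g -> closed [set x | f x = g x].
Proof.
move=> cf cg.
have -> : [set x | f x = g x] =
    \bigcap_(k : 'I_m * 'I_n) [set x | f x k.1 k.2 - g x k.1 k.2 = 0].
  apply/seteqP; split=> x /= fg; first by move=> k _ /=; rewrite fg subrr.
  by apply/matrixP => i j; apply/eqP; rewrite -subr_eq0; apply/eqP/(fg (i, j)).
apply: closed_bigI => k _; apply: closed_eq0 => x.
by apply: (@cvgB _ _ _ (nbhs x)); apply: cvg_mx_coord; first [exact: (cf x)|exact: (cg x)].
Qed.

End MatrixTopology.

(** * Compact sets of complex matrices and the closed graph principle *)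

Section ComplexMatrixTopology.
Variables (R : realType) (C : complexOver R).

Lemma cvg_trmxC T (F : set_system T) {FF : Filter F} m n
  (f : T -> 'M[C]_(m, n)) (A : 'M[C]_(m, n)) :
  f @ F --> A -> (f x) ^t* @[x --> F] --> A ^t*.
Proof.
move=> fA; apply: cvg_mx => i j; rewrite !mxE.
under eq_fun do rewrite !mxE.
apply: (@continuous_cvg _ _ _ F _ (fun x => f x j i) (fun z : C => z^*)).
  exact: conjC_continuous.
exact: cvg_mx_coord.
Qed.

(** A bounded disc of [C] lies in the image of a square of [R * R]. Compactness of the product of
    such squares is obtained for row vectors and carried to matrices by [vec_mx]. *)
Lemma compact_box m n (c : R) : exists2 B : set 'M[C]_(m, n),
  compact B &
  forall A : 'M[C]_(m, n), (forall i j, `|A i j| <= ofR c) -> B A.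
Proof.
pose D : set C := (fun x : R * R => ofR x.1 + 'i * ofR x.2) @`
  (`[- c, c] `*` `[- c, c]).
have cD : compact D.
  apply: continuous_compact; last by apply: compact_setX; exact: segment_compact.
  apply: continuous_subspaceT => x; apply: (@cvgD _ _ _ (nbhs x)).
    by apply: cvg_comp; [exact: cvg_fst|exact: ofR_continuous].
  apply: (@cvgM _ _ (nbhs x)); first exact: cvg_cst.
  by apply: cvg_comp; [exact: cvg_snd|exact: ofR_continuous].
have cV := @rV_compact C (m * n) (fun=> D) (fun=> cD).
eexists; first apply: (continuous_compact (f := @vec_mx C m n) _ cV).
  apply: continuous_subspaceT => v; apply: (@cvg_mx _ _ (nbhs v)) => i j; rewrite mxE.
  by under eq_fun do rewrite mxE; exact: coord_continuous.
move=> A Ac; exists (mxvec A); last exact: mxvecK.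
move=> k /=; case/mxvec_indexP: k => i j; rewrite mxvecE.
have Dz (z : C) : `|z| <= ofR c -> D z.
  move=> zc; have [b bE] := ofR_real (Creal_Im z).
  exists (Rep z, b); last by rewrite /= ofR_Rep -bE -Crect.
  have H (a : R) : ofR `|a| <= (ofR c : C) -> `[- c, c]%classic a.
    by rewrite ler_ofR /= in_itv /= ler_norml.
  split; apply: H; apply: le_trans zc; first exact: norm_Rep.
  (* The bound on the imaginary part is the bound on the real part of [z * 'i]. *)
  have -> : `|z| = `|z * 'i| by rewrite normrM normCi mulr1.
  rewrite -norm_ofR /= -bE -(normrN ('Im z)) -ReMir.
  by case: (leif_normC_Re_Creal (z * 'i)).
exact: Dz.
Qed.

Lemma closed_bounded_compact m n (S : set 'M[C]_(m, n)) (c : R) : closed S ->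
  (forall A, S A -> forall i j, `|A i j| <= ofR c) -> compact S.
Proof.
move=> cS Sc; have [B cB sB] := compact_box m n c.
by apply: subclosed_compact cS cB _ => A /Sc; exact: sB.
Qed.

(* Closed graph principle: [g] need not be continuous, only locally bounded
   with values constrained by the closed relation [S]. *)
Lemma closed_graph_continuous (T Z V : topologicalType) (A : set T)
    (f : T -> V) (g : T -> Z) (h : T * Z -> V) (S : set (T * Z)) :
  closed S -> (forall x, A x -> S (x, g x)) ->
  (forall x, A x -> f x = h (x, g x)) ->
  (forall x z, A x -> S (x, z) -> h (x, z) = f x) ->
  (forall x z, A x -> S (x, z) -> {for (x, z), continuous h}) ->
  (forall x, A x -> exists2 B, compact B & within A (nbhs x) (fun y => B (g y))) ->
  {within A, continuous f}.
Proof.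
move=> cS Sg fE hE hc gB; apply/subspace_continuousP => a Aa V0 fV0.
have [B cB BA] := gB a Aa; apply: contrapT => nV.
(* If [f] is not continuous at [a], the points where [f] leaves [V0] form a proper filter at [a].
   Its image under [g] clusters at some [z] in [B]; closedness of [S] puts [(a, z)] in [S], and
   continuity of [h] there brings [f] back into [V0]. *)
pose F := within (A `&` ~` (f @^-1` V0)) (nbhs a).
have FF : ProperFilter F.
  apply: Build_ProperFilter_ex => P FP; apply: contrapT => nP.
  apply: nV; rewrite /fmap /=; move: FP; rewrite /F /within /=.
  apply: filterS => x Px Ax; apply: contrapT => nVx; apply: nP.
  by exists x; apply: Px.
have FA : F (fun x => A x /\ ~ V0 (f x)).
  by rewrite /F /within /=; apply: filterE => x.
have gFB : (g @ F) B.
  by move: BA; rewrite /fmap /F /within /=; apply: filterS => x H [/H].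
have [z [Bz clz]] := cB (g @ F) _ gFB.
have Saz : S (a, z).
  rewrite (closure_id S).1 //= => U [[U1 U2] /= [aU1 zU2] sU].
  have : (g @ F) (g @` (U1 `&` A)).
    rewrite /fmap /F /within /=; move: aU1; apply: filterS => x U1x [Ax _].
    by exists x.
  move=> /clz /(_ zU2)[_ [[x [U1x Ax] <-] U2x]].
  by exists (x, g x); split; [exact: Sg|exact: sU].
have := hc a z Aa Saz V0; rewrite hE // => /(_ fV0) [[U1 U2] /= [aU1 zU2] sU].
have : (g @ F) (g @` (U1 `&` [set x | A x /\ ~ V0 (f x)])).
  rewrite /fmap /F /within /=; move: aU1; apply: filterS => x U1x Ax.
  by exists x.
move=> /clz /(_ zU2)[_ [[x [U1x [Ax nVx]] <-] U2x]]; apply: nVx.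
by rewrite fE //; exact: (sU (x, g x)).
Qed.

End ComplexMatrixTopology.

(** * Positive definite matrices and their real powers *)

Section PositiveMatrices.
Variables (R : realType) (C : complexOver R).

Lemma half_add : 2^-1 + 2^-1 = 1 :> R.
Proof. by rewrite [RHS]splitr mul1r. Qed.

Lemma trmxC_mul m n p (A : 'M[C]_(m, n)) (B : 'M[C]_(n, p)) :
  (A *m B) ^t* = B ^t* *m A ^t*.
Proof. by rewrite trmx_mul map_mxM. Qed.

Lemma trmxC1 n : (1%:M : 'M[C]_n) ^t* = 1%:M.
Proof. by rewrite trmx1 map_mx1. Qed.

Lemma trmxCD m n (A B : 'M[C]_(m, n)) : (A + B) ^t* = A ^t* + B ^t*.
Proof. by rewrite linearD map_mxD. Qed.

Lemma trmxCN m n (A : 'M[C]_(m, n)) : (- A) ^t* = - A ^t*.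
Proof. by rewrite linearN map_mxN. Qed.

Lemma trmxC_unit n (A : 'M[C]_n) : (A ^t* \in unitmx) = (A \in unitmx).
Proof. by rewrite map_unitmx unitmx_tr. Qed.

Lemma trmxC_inv n (A : 'M[C]_n) : (invmx A) ^t* = invmx (A ^t*).
Proof. by rewrite trmx_inv map_invmx. Qed.

Lemma det_trmxC n (A : 'M[C]_n) : \det (A ^t*) = (\det A)^*.
Proof. by rewrite det_map_mx det_tr. Qed.

Lemma unitarymxK n (U : 'M[C]_n) : U \is unitarymx ->
  U *m U ^t* = 1%:M /\ U ^t* *m U = 1%:M.
Proof. by move=> /unitarymxP UU; split=> //; exact: mulmx1C. Qed.

Lemma normsq_mx m n (X : 'M[C]_(m, n)) :
  \tr (X ^t* *m X) = \sum_j \sum_i `|X i j| ^+ 2.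
Proof.
apply: eq_bigr => j _; rewrite mxE; apply: eq_bigr => i _.
by rewrite !mxE normCK mulrC.
Qed.

Lemma normsq_mx_ge0 m n (X : 'M[C]_(m, n)) : 0 <= \tr (X ^t* *m X).
Proof.
by rewrite normsq_mx !sumr_ge0// => j _; apply: sumr_ge0 => i _; rewrite exprn_ge0.
Qed.

Lemma normsq_mx_eq0 m n (X : 'M[C]_(m, n)) : \tr (X ^t* *m X) = 0 -> X = 0.
Proof.
rewrite normsq_mx => X0; apply/matrixP => i j; rewrite mxE; apply/eqP.
have /(_ j isT) := psumr_eq0P (fun j _ => sumr_ge0 _ (fun i _ => exprn_ge0 2 (normr_ge0 (X i j)))) X0.
move=> /(psumr_eq0P (fun i _ => exprn_ge0 2 (normr_ge0 (X i j)))) /(_ i isT)/eqP.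
by rewrite expf_eq0 /= normr_eq0.
Qed.

Definition psdmx n (P : 'M[C]_n) : Prop :=
  P ^t* = P /\ forall v : 'rV[C]_n, 0 <= (v *m P *m v ^t*) 0 0.

Definition posdef n (P : 'M[C]_n) : Prop := psdmx P /\ P \in unitmx.

Lemma psdmx1 n : psdmx (1%:M : 'M[C]_n).
Proof.
split=> [|v]; first exact: trmxC1.
rewrite mulmx1 mxE sumr_ge0 // => i _; rewrite !mxE -normCK.
by rewrite exprn_ge0.
Qed.

Lemma posdef1 n : posdef (1%:M : 'M[C]_n).
Proof. by split; [exact: psdmx1|exact: unitmx1]. Qed.

Lemma psdmx_conj m n (P : 'M[C]_n) (B : 'M[C]_(n, m)) :
  psdmx P -> psdmx (B ^t* *m P *m B).
Proof.
move=> [Ph P0]; split; first by rewrite !trmxC_mul Ph trmxCK mulmxA.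
move=> v; have := P0 (v *m B ^t*).
by rewrite trmxC_mul trmxCK !mulmxA.
Qed.

Lemma posdef_conj n (P B : 'M[C]_n) :
  B \in unitmx -> posdef P -> posdef (B ^t* *m P *m B).
Proof.
move=> uB [P0 uP]; split; first exact: psdmx_conj.
by rewrite !unitmx_mul trmxC_unit uB uP.
Qed.

Lemma posdef_gram n (B : 'M[C]_n) : B \in unitmx -> posdef (B ^t* *m B).
Proof.
by move=> uB; have := posdef_conj uB (posdef1 n); rewrite mulmx1.
Qed.

(** Positive diagonal matrices are parametrized by the logarithms of their entries, which turns real
    powers into scalings of [l]. *)
Definition ediag n (l : 'rV[R]_n) : 'M[C]_n :=
  diag_mx (map_mx (fun x => ofR (expR x)) l).

Lemma ediagE n (l : 'rV_n) i j : ediag l i j = ofR (expR (l 0 j)) *+ (i == j).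
Proof.
by rewrite !mxE; case: eqP => [->|].
Qed.

Lemma mul_mx_ediag m n (A : 'M[C]_(m, n)) l i j :
  (A *m ediag l) i j = A i j * ofR (expR (l 0 j)).
Proof. by rewrite /ediag mul_mx_diag !mxE. Qed.

Lemma mul_ediag_mx m n (A : 'M[C]_(m, n)) l i j :
  (ediag l *m A) i j = ofR (expR (l 0 i)) * A i j.
Proof. by rewrite /ediag mul_diag_mx !mxE. Qed.

Lemma det_ediag n (l : 'rV_n) : \det (ediag l) = ofR (expR (\sum_i l 0 i)).
Proof.
rewrite det_diag expR_sum rmorph_prod.
by apply: eq_bigr => i _; rewrite mxE.
Qed.

Lemma ediag_diag n (d : 'rV[C]_n) : (forall i, 0 < d 0 i) ->
  diag_mx d = ediag (map_mx (fun z => ln (Rep z)) d).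
Proof.
move=> d0; rewrite /ediag; congr diag_mx.
apply/rowP => i; rewrite mxE mxE lnK; first exact/ge0_ofR/ltW.
by rewrite posrE; exact: Rep_lt (d0 i).
Qed.

Lemma ediag0 n : ediag (0 : 'rV_n) = 1%:M.
Proof.
apply/matrixP => i j; rewrite !mxE expR0 rmorph1.
by case: (i == j).
Qed.

Lemma ediagD n (l m : 'rV_n) : ediag (l + m) = ediag l *m ediag m.
Proof.
rewrite /ediag mulmx_diag; congr diag_mx; apply/rowP => i.
by rewrite !mxE expRD rmorphM.
Qed.

Lemma ediag_trmxC n (l : 'rV_n) : (ediag l) ^t* = ediag l.
Proof.
rewrite /ediag tr_diag_mx map_diag_mx; congr diag_mx; apply/rowP => i.
by rewrite !mxE; exact: conj_ofR.
Qed.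

Lemma ediag_unit n (l : 'rV_n) : ediag l \in unitmx.
Proof.
have : ediag l *m ediag (- l) = 1%:M by rewrite -ediagD subrr ediag0.
by case/mulmx1_unit => uE _.
Qed.

Lemma ediag_half n (l : 'rV_n) : ediag l = ediag (2^-1 *: l) *m ediag (2^-1 *: l).
Proof. by rewrite -ediagD -scalerDl half_add scale1r. Qed.

(** Entrywise, a nonzero [W i j] forces [l 0 j = k 0 i], and this equality survives scaling. *)
Lemma ediag_intertwine m n (W : 'M[C]_(m, n)) l k t :
  W *m ediag l = ediag k *m W -> W *m ediag (t *: l) = ediag (t *: k) *m W.
Proof.
move=> WE; apply/matrixP => i j; move/matrixP: WE => /(_ i j).
rewrite !mul_mx_ediag !mul_ediag_mx [(t *: l) 0 j]mxE [(t *: k) 0 i]mxE.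
have [->|W0] := eqVneq (W i j) 0; first by rewrite !mul0r !mulr0.
rewrite mulrC => /(mulIf W0) /ofR_inj/expR_inj ->.
by rewrite mulrC.
Qed.

Definition eigexp n (U : 'M[C]_n) (l : 'rV[R]_n) : 'M[C]_n :=
  U ^t* *m ediag l *m U.

Lemma eigexp_posdef n (U : 'M[C]_n) l :
  U \is unitarymx -> posdef (eigexp U l).
Proof.
move=> uU; rewrite /eigexp ediag_half mulmxA -mulmxA.
have := posdef_gram (B := ediag (2^-1 *: l) *m U).
rewrite trmxC_mul ediag_trmxC; apply.
by rewrite unitmx_mul ediag_unit unitarymx_unit.
Qed.

Lemma posdef_eigexp n (P : 'M[C]_n) : posdef P ->
  exists Ul : 'M[C]_n * 'rV[R]_n, Ul.1 \is unitarymx /\ P = eigexp Ul.1 Ul.2.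
Proof.
move=> [[Ph P0] uP].
have /orthomx_spectralP : P \is normalmx by apply/normalmxP; rewrite Ph.
move: (spectralmx P) (spectral_diag P) (spectral_unitarymx P) => U d uU PE.
have [UU' U'U] := unitarymxK uU.
have DE : diag_mx d = U *m P *m U ^t*.
  by rewrite PE (invmx_unitary uU) !mulmxA UU' mul1mx -mulmxA UU' mulmx1.
have d0 i : 0 < d 0 i.
  rewrite lt_def; apply/andP; split.
    have : diag_mx d \in unitmx.
      by rewrite DE !unitmx_mul trmxC_unit uP unitarymx_unit.
    rewrite unitmxE det_diag unitfE => /prodf_neq0; exact.
  (* The [i]-th eigenvalue is the value of the form [P] at the [i]-th row of [U]. *)
  have := P0 (row i U); rewrite -[X in 0 <= X -> _]/(_ 0 0).
  have -> : (row i U *m P *m (row i U) ^t*) 0 0 = (diag_mx d) i i.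
    rewrite DE -!row_mul !mxE; apply: eq_bigr => k _.
    by rewrite !mxE.
  by rewrite mxE eqxx mulr1n.
exists (U, map_mx (fun z => ln (Rep z)) d); split; first exact: uU.
by rewrite /eigexp /= -ediag_diag // -(invmx_unitary uU) {1}PE.
Qed.

(** An arbitrary diagonalization, neither canonical nor continuous in [P]. By [mxpowE] the powers do
    not depend on it. *)
Definition posdiag n (P : 'M[C]_n) : 'M[C]_n * 'rV[R]_n :=
  xget (1%:M, 0) [set Ul | Ul.1 \is unitarymx /\ P = eigexp Ul.1 Ul.2].

Definition mxpow n (P : 'M[C]_n) (t : R) : 'M[C]_n :=
  eigexp (posdiag P).1 (t *: (posdiag P).2).

Lemma posdiagP n (P : 'M[C]_n) : posdef P ->
  (posdiag P).1 \is unitarymx /\ P = eigexp (posdiag P).1 (posdiag P).2.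
Proof.
by move=> /posdef_eigexp[Ul UlP]; rewrite /posdiag; case: xgetP => [x _ //|/(_ Ul)].
Qed.

(** In the eigenbases [B] becomes [W = V B U^*], which reduces the claim to diagonal matrices. The
    case [B = 1] shows that real powers are independent of the diagonalization. *)
Lemma eigexp_intertwine n (B U V : 'M[C]_n) l m t :
  U \is unitarymx -> V \is unitarymx ->
  B *m eigexp U l = eigexp V m *m B ->
  B *m eigexp U (t *: l) = eigexp V (t *: m) *m B.
Proof.
move=> /unitarymxK[UU' U'U] /unitarymxK[VV' V'V] BE.
pose W := V *m B *m U ^t*.
have BW : B = V ^t* *m W *m U by rewrite /W !mulmxA V'V mul1mx -mulmxA U'U mulmx1.
have WE : W *m ediag l = ediag m *m W.
  have -> : W *m ediag l = V *m (B *m eigexp U l) *m U ^t*.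
    by rewrite /W /eigexp !mulmxA -[in RHS](mulmxA _ U) UU' mulmx1.
  by rewrite BE /eigexp /W !mulmxA VV' mul1mx.
clearbody W; have WtE := ediag_intertwine t WE.
transitivity (V ^t* *m (W *m ediag (t *: l)) *m U).
  by rewrite BW /eigexp !mulmxA -(mulmxA _ U) UU' mulmx1.
rewrite WtE BW /eigexp !mulmxA.
rewrite -(mulmxA _ V) VV' mulmx1; reflexivity.
Qed.

Lemma mxpowE n (U : 'M[C]_n) l t : U \is unitarymx ->
  mxpow (eigexp U l) t = eigexp U (t *: l).
Proof.
move=> uU; have [uV PE] := posdiagP (eigexp_posdef l uU).
rewrite /mxpow; set V := (posdiag _).1 in uV PE *.
set m := (posdiag _).2 in PE *.
have := @eigexp_intertwine n 1%:M V U m l t uV uU.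
rewrite mul1mx mulmx1 mul1mx mulmx1 => H.
exact: (H (esym PE)).
Qed.

Lemma mxpow_intertwine n (B P Q : 'M[C]_n) t : posdef P -> posdef Q ->
  B *m P = Q *m B -> B *m mxpow P t = mxpow Q t *m B.
Proof.
move=> /posdef_eigexp[[U l] [/= uU ->]] /posdef_eigexp[[V m] [/= uV ->]].
by move=> /(eigexp_intertwine t uU uV); rewrite (mxpowE _ _ uU) (mxpowE _ _ uV).
Qed.

Lemma mxpow0 n (P : 'M[C]_n) : posdef P -> mxpow P 0 = 1%:M.
Proof.
move=> /posdef_eigexp[[U l] [/= uU ->]]; rewrite (mxpowE _ _ uU) scale0r /eigexp.
by rewrite ediag0 mulmx1 (unitarymxK uU).2.
Qed.

Lemma mxpow1 n (P : 'M[C]_n) : posdef P -> mxpow P 1 = P.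
Proof.
by move=> /posdef_eigexp[[U l] [/= uU ->]]; rewrite (mxpowE _ _ uU) scale1r.
Qed.

Lemma mxpowD n (P : 'M[C]_n) s t : posdef P ->
  mxpow P (s + t) = mxpow P s *m mxpow P t.
Proof.
move=> /posdef_eigexp[[U l] [/= uU ->]]; rewrite !(mxpowE _ _ uU).
rewrite /eigexp scalerDl ediagD.
by rewrite -[X in _ = X]mulmxA (mulmxA U) (mulmxA U) (unitarymxK uU).1 mul1mx !mulmxA.
Qed.

Lemma mxpow_posdef n (P : 'M[C]_n) t : posdef P -> posdef (mxpow P t).
Proof.
move=> /posdef_eigexp[[U l] [/= uU ->]]; rewrite (mxpowE _ _ uU).
exact: eigexp_posdef.
Qed.

Lemma posdef_herm n (P : 'M[C]_n) : posdef P -> P ^t* = P.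
Proof. by case=> -[]. Qed.

Lemma posdef_unit n (P : 'M[C]_n) : posdef P -> P \in unitmx.
Proof. by case. Qed.

Lemma mxpowN n (P : 'M[C]_n) t : posdef P ->
  mxpow P (- t) = invmx (mxpow P t).
Proof.
move=> pP; have uPt := posdef_unit (mxpow_posdef t pP).
by rewrite -[LHS](mulKmx uPt) -(mxpowD _ _ pP) subrr (mxpow0 pP) mulmx1.
Qed.

Lemma mxpow1mx n t : mxpow (1%:M : 'M[C]_n) t = 1%:M.
Proof.
have u1 : (1%:M : 'M[C]_n) \is unitarymx.
  by apply/unitarymxP; rewrite trmxC1 mulmx1.
have E : (1%:M : 'M[C]_n) = eigexp 1%:M 0.
  by rewrite /eigexp ediag0 !mulmx1 trmxC1.
by rewrite {1}E (mxpowE _ _ u1) scaler0.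
Qed.

Lemma mxpow_nat n (P : 'M[C]_n) k : posdef P -> mxpow P k%:R = P ^+ k.
Proof.
move=> pP; elim: k => [|k IHk]; first exact: mxpow0.
by rewrite -addn1 natrD (mxpowD _ _ pP) IHk (mxpow1 pP) addn1 exprSr.
Qed.

Lemma mxpow_half n (P : 'M[C]_n) : posdef P ->
  mxpow P 2^-1 *m mxpow P 2^-1 = P.
Proof. by move=> pP; rewrite -(mxpowD _ _ pP) half_add (mxpow1 pP). Qed.

Lemma unitarymx_entry n (U : 'M[C]_n) i j : U \is unitarymx -> `|U i j| <= 1.
Proof.
move=> uU; have := congr1 (fun X : 'M[C]_n => X i i) (unitarymxK uU).1.
rewrite /= mxE mxE eqxx mulr1n => UE.
rewrite -(@ler_pXn2r _ 2) ?nnegrE // expr1n.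
rewrite -UE (bigD1 j) //= !mxE -normCK lerDl sumr_ge0 // => k _.
by rewrite !mxE -normCK exprn_ge0.
Qed.

Lemma eigexp_trace n (U : 'M[C]_n) l : U \is unitarymx ->
  \tr (eigexp U l) = ofR (\sum_i expR (l 0 i)).
Proof.
move=> uU; rewrite /eigexp mxtrace_mulC mulmxA (unitarymxK uU).1 mul1mx.
by rewrite rmorph_sum; apply: eq_bigr => i _; rewrite ediagE eqxx mulr1n.
Qed.

Lemma eigexp_det n (U : 'M[C]_n) l : U \is unitarymx ->
  \det (eigexp U l) = ofR (expR (\sum_i l 0 i)).
Proof.
move=> uU; rewrite /eigexp !det_mulmx mulrAC -det_mulmx (unitarymxK uU).2.
by rewrite det1 mul1r det_ediag.
Qed.

(** The trace is the sum of the positive eigenvalues and unitary matrices have entries of norm at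
    most 1. This bound makes sets of positive matrices of bounded trace bounded. *)
Lemma posdef_entry n (P : 'M[C]_n) i j : posdef P ->
  `|P i j| <= ofR (Rep (\tr P)).
Proof.
move=> /posdef_eigexp[[U l] [/= uU ->]]; rewrite eigexp_trace // ofRK.
rewrite /eigexp mxE; apply: le_trans (ler_norm_sum _ _ _) _.
rewrite rmorph_sum; apply: ler_sum => k _.
have uUt : U ^t* \is unitarymx by rewrite trmxC_unitary.
rewrite mul_mx_ediag.
rewrite !normrM norm_ofR (ger0_norm (expR_ge0 _)).
have e0 : 0 <= ofR (expR (l 0 k)) :> C by rewrite ofR_ge0 expR_ge0.
rewrite mulrAC; apply: ler_piMl => //.
exact: mulr_ile1 (normr_ge0 _) (normr_ge0 _) (unitarymx_entry _ _ uUt)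
  (unitarymx_entry _ _ uU).
Qed.

End PositiveMatrices.

Arguments ediag {R C n} l.

(** * Continuity of the inverse *)

Section InverseContinuity.
Variable K : numFieldType.

Lemma cvg_adjugate T (F : set_system T) {FF : Filter F} n
  (f : T -> 'M[K]_n) (A : 'M[K]_n) :
  f @ F --> A -> \adj (f x) @[x --> F] --> \adj A.
Proof.
move=> fA; apply: cvg_mx => i j; rewrite mxE.
under eq_fun do rewrite mxE.
apply: cvgM; first exact: cvg_cst.
apply: cvg_det; apply: cvg_mx => k l; rewrite !mxE.
by under eq_fun do rewrite !mxE; exact: cvg_mx_coord.
Qed.

(** Cramer's formula. Since [invmx] is the identity on singular matrices, [f x] has to be invertible
    near the limit. *)
Lemma cvg_invmx T (F : set_system T) {FF : Filter F} n
  (f : T -> 'M[K]_n) (A : 'M[K]_n) : A \in unitmx ->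
  (\forall x \near F, f x \in unitmx) ->
  f @ F --> A -> invmx (f x) @[x --> F] --> invmx A.
Proof.
move=> uA uf fA.
have H : (\det (f x))^-1 *: \adj (f x) @[x --> F] --> invmx A.
  rewrite /invmx uA; apply: cvg_scalemx; last exact: cvg_adjugate.
  by apply: cvgV; [rewrite -unitfE -unitmxE|exact: cvg_det].
apply: cvg_trans H; apply: near_eq_cvg; apply: filterS uf => x ufx.
by rewrite /invmx ufx.
Qed.

End InverseContinuity.

(** * Continuity of real powers and midpoint convexity *)

Section MatrixPowers.
Variables (R : realType) (C : complexOver R).

Lemma cvg_ediag T (F : set_system T) {FF : Filter F} n
  (f : T -> 'rV[R]_n) (l : 'rV[R]_n) :
  f @ F --> l -> (ediag (f x) : 'M[C]_n) @[x --> F] --> (ediag l : 'M[C]_n).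
Proof.
move=> fl; apply: cvg_mx => i j; rewrite ediagE.
under eq_fun do rewrite ediagE.
case: (i == j); last exact: cvg_cst.
apply: (@continuous_cvg _ _ _ F _ (fun x => expR (f x 0 j)) (@ofR R C)).
  exact: ofR_continuous.
apply: (@continuous_cvg _ _ _ F _ (fun x => f x 0 j) (@expR R)).
  exact: continuous_expR.
exact: cvg_mx_coord.
Qed.

Lemma cvg_eigexp T (F : set_system T) {FF : Filter F} n
  (f : T -> 'M[C]_n) (g : T -> 'rV[R]_n) (U : 'M[C]_n) (l : 'rV[R]_n) :
  f @ F --> U -> g @ F --> l -> eigexp (f x) (g x) @[x --> F] --> eigexp U l.
Proof.
move=> fU gl; apply: cvg_mulmx => //; apply: cvg_mulmx; first exact: cvg_trmxC.
exact: cvg_ediag.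
Qed.

Lemma cvg_Rep_tr T (F : set_system T) {FF : Filter F} n
  (f : T -> 'M[C]_n) (A : 'M[C]_n) :
  f @ F --> A -> Rep (\tr (f x)) @[x --> F] --> Rep (\tr A).
Proof.
move=> fA; apply: (@continuous_cvg _ _ _ F _ (fun x => \tr (f x)) (@Rep R C)).
  exact: Rep_continuous.
exact: cvg_mxtrace.
Qed.

(** Both [exp l_i] and [exp (- l_i)] are bounded by a trace, and [x <= exp x]. The chosen logarithms
    are therefore locally bounded, as the closed graph principle demands. *)
Lemma posdiag_bound n (P : 'M[C]_n) i : posdef P ->
  `|(posdiag P).2 0 i| <= Rep (\tr P) + Rep (\tr (invmx P)).
Proof.
move=> pP; have [uU PE] := posdiagP pP.
have e0 l j : 0 <= \sum_(k < n | k != j) expR ((l : 'rV[R]_n) 0 k).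
  by apply: sumr_ge0 => k _; rewrite expR_ge0.
have -> : invmx P = mxpow P (-1) by rewrite mxpowN // mxpow1.
rewrite [in X in _ <= X + _]PE /mxpow !eigexp_trace // !ofRK.
set l := (posdiag P).2; rewrite (bigD1 i) //= [X in _ + X](bigD1 i) //= mxE mulN1r.
have ge_exp x : x <= expR x :> R.
  by apply: le_trans (expR_ge1Dx x); rewrite lerDr.
have := ge_exp (l 0 i); have := ge_exp (- l 0 i).
have := expR_ge0 (l 0 i); have := expR_ge0 (- l 0 i).
have := e0 l i; have := e0 (- 1 *: l) i.
by rewrite ler_norml => *; apply/andP; split; lra.
Qed.

Lemma closed_unitarymx n : closed [set U : 'M[C]_n | U \is unitarymx].
Proof.
have -> : [set U : 'M[C]_n | U \is unitarymx] = [set U | U *m U ^t* = 1%:M].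
  by apply/seteqP; split=> U /= /unitarymxP.
apply: closed_eqmx => [U|]; last exact: cst_continuous.
by apply: (@cvg_mulmx _ _ (nbhs U)); [|apply: (@cvg_trmxC _ _ _ (nbhs U))]; exact: cvg_id.
Qed.

(** The closed graph principle with [g] the chosen diagonalization: [S] says that [(U, l)]
    diagonalizes [P], a closed condition, and every such pair yields the same power. *)
Lemma mxpow_continuous n :
  {within [set z : R * 'M[C]_n | posdef z.2],
   continuous (fun z => mxpow z.2 z.1)}.
Proof.
pose h (w : (R * 'M[C]_n) * ('M[C]_n * 'rV[R]_n)) :=
  eigexp w.2.1 (w.1.1 *: w.2.2).
pose S : set ((R * 'M[C]_n) * ('M[C]_n * 'rV[R]_n)) :=
  [set w | w.2.1 \is unitarymx] `&` [set w | w.1.2 = eigexp w.2.1 w.2.2].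
apply: (@closed_graph_continuous _ _ _ _ _ (fun z => posdiag z.2) h S).
- apply: closedI.
    apply: (@closed_comp _ _ (fun w : _ * ('M[C]_n * 'rV[R]_n) => w.2.1)) (@closed_unitarymx n).
    move=> w _; apply: (@cvg_comp _ _ _ snd fst _ (nbhs w.2)).
      exact: cvg_snd.
    exact: cvg_fst.
  apply: closed_eqmx => w.
    apply: (@cvg_comp _ _ _ fst snd _ (nbhs w.1)).
      exact: cvg_fst.
    exact: cvg_snd.
  apply: (@cvg_eigexp _ (nbhs w)).
    by apply: (@cvg_comp _ _ _ snd fst _ (nbhs w.2)); [exact: cvg_snd|exact: cvg_fst].
  by apply: (@cvg_comp _ _ _ snd snd _ (nbhs w.2)); [exact: cvg_snd|exact: cvg_snd].
- by move=> z /= /posdiagP[? ?]; split.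
- by [].
- move=> [t P] [U l] /= pP [/= uU PE]; rewrite /h /=.
  by rewrite PE mxpowE.
- move=> z w _ _; apply: (@cvg_eigexp _ (nbhs (z, w))).
    by apply: (@cvg_comp _ _ _ snd fst _ (nbhs w)); [exact: cvg_snd|exact: cvg_fst].
  apply: (@cvg_scalemx _ _ (nbhs (z, w))).
    by apply: (@cvg_comp _ _ _ fst fst _ (nbhs z)); [exact: cvg_fst|exact: cvg_fst].
  by apply: (@cvg_comp _ _ _ snd snd _ (nbhs w)); [exact: cvg_snd|exact: cvg_snd].
- move=> [t P] /= pP.
  pose phi (z : R * 'M[C]_n) := Rep (\tr z.2) + Rep (\tr (invmx z.2)).
  have [B1 cB1 B1P] := @compact_box R C n n 1.
  pose c := phi (t, P) + 1.
  exists (B1 `*` [set l : 'rV[R]_n | forall i, `[- c, c]%classic (l 0 i)]).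
    apply: compact_setX => //; apply: (@rV_compact R n (fun=> `[- c, c]%classic)).
    by move=> i; exact: segment_compact.
  have cphi : phi @ within [set z | posdef z.2] (nbhs (t, P)) --> phi (t, P).
    have c2 : z.2 @[z --> within [set z : R * 'M[C]_n | posdef z.2] (nbhs (t, P))] --> P.
      by apply: cvg_within_filter; exact: cvg_snd.
    apply: cvgD; first exact: cvg_Rep_tr.
    apply: cvg_Rep_tr; apply: cvg_invmx => //; first exact: posdef_unit.
    by rewrite near_withinE; apply: filterE => z; exact: posdef_unit.
  have ltc : phi (t, P) < c by rewrite ltrDl.
  have : \forall z \near within [set z | posdef z.2] (nbhs (t, P)), phi z <= c.
    by apply: (cvgr_le _ cphi).
  rewrite !near_withinE; apply: filterS => -[u Q] /= Qc pQ.
  have [uU _] := posdiagP pQ; split=> /=.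
    by apply: B1P => i j; rewrite rmorph1 unitarymx_entry.
  move=> i; rewrite /= in_itv /= -ler_norml.
  exact: le_trans (posdiag_bound _ pQ) (Qc pQ).
Qed.

(** For positive [Q] this is the squared Frobenius norm of [Q^(1/2) k]. *)
Definition qtr n (k Q : 'M[C]_n) : R := Rep (\tr (k ^t* *m Q *m k)).

Lemma qtr_is_zmod n (k : 'M[C]_n) : zmod_morphism (qtr k).
Proof. by move=> P Q; rewrite /qtr mulmxBr mulmxBl !raddfB. Qed.
HB.instance Definition _ n (k : 'M[C]_n) :=
  GRing.isZmodMorphism.Build 'M[C]_n R (qtr k) (qtr_is_zmod k).

(** The geometric mean, that is, the midpoint of the geodesic from [Q1] to [Q2] in the symmetric
    space of positive matrices. *)
Definition mxmid n (Q1 Q2 : 'M[C]_n) : 'M[C]_n :=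
  let A := mxpow Q1 2^-1 in
  A *m mxpow (invmx A *m Q2 *m invmx A) 2^-1 *m A.

Lemma posdef_conj_herm n (P B : 'M[C]_n) : B ^t* = B ->
  B \in unitmx -> posdef P -> posdef (B *m P *m B).
Proof. by move=> Bh uB pP; rewrite -{1}Bh; exact: posdef_conj. Qed.

Lemma mxmid_posdef n (Q1 Q2 : 'M[C]_n) :
  posdef Q1 -> posdef Q2 -> posdef (mxmid Q1 Q2).
Proof.
move=> p1 p2; have pA := mxpow_posdef 2^-1 p1; rewrite /mxmid /=.
set A := mxpow Q1 _ in pA *.
have Ah := posdef_herm pA; have uA := posdef_unit pA.
apply: posdef_conj_herm => //; apply: mxpow_posdef.
by apply: posdef_conj_herm; rewrite ?trmxC_inv ?Ah ?unitmx_inv.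
Qed.

(* With [A = Q1^(1/2)], [B = A^-1 Q2 A^-1] and [S = B^(1/2)], the defect of
   midpoint convexity is [tr (X^* X)] for [X = (1 - S) A k]. *)
Lemma mxmid_lt n (Q1 Q2 k : 'M[C]_n) :
  posdef Q1 -> posdef Q2 -> Q1 <> Q2 -> k \in unitmx ->
  qtr k (mxmid Q1 Q2) *+ 2 < qtr k Q1 + qtr k Q2.
Proof.
move=> p1 p2 neqQ uk; have pA := mxpow_posdef 2^-1 p1; rewrite /mxmid /=.
have := mxpow_half p1; set A := mxpow Q1 _ in pA * => AA; clearbody A.
have Ah := posdef_herm pA; have uA := posdef_unit pA.
set B := invmx A *m Q2 *m invmx A.
have pB : posdef B.
  by apply: posdef_conj_herm; rewrite ?trmxC_inv ?Ah ?unitmx_inv.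
have pS := mxpow_posdef 2^-1 pB; have := mxpow_half pB.
set S := mxpow B _ in pS * => SS; clearbody S; have Sh := posdef_herm pS.
have Q2E : Q2 = A *m B *m A.
  by rewrite /B !mulmxA (mulmxV uA) mul1mx (mulmxKV uA).
pose X := (1%:M - S) *m A *m k.
have XX : X ^t* *m X = k ^t* *m (Q1 + Q2 - (A *m S *m A) *+ 2) *m k.
  have SSE : (1%:M - S) *m (1%:M - S) = 1%:M + B - S *+ 2.
    rewrite mulmxBl mul1mx mulmxBr mulmx1 SS mulr2n opprB opprD !addrA.
    by rewrite (addrAC _ (- S) B).
  rewrite /X !trmxC_mul trmxCD trmxCN trmxC1 Sh Ah.
  transitivity (k ^t* *m (A *m ((1%:M - S) *m (1%:M - S)) *m A) *m k).
    by rewrite !mulmxA.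
  rewrite SSE mulr2n (mulmxBr A) (mulmxDr A 1%:M) (mulmxDr A S) mulmx1.
  by rewrite (mulmxBl _ _ A) (mulmxDl A) (mulmxDl (A *m S)) AA -Q2E -mulr2n.
have X0 : \tr (X ^t* *m X) != 0.
  apply/eqP => /normsq_mx_eq0 /(congr1 (fun Y => Y *m invmx k *m invmx A)).
  rewrite /X mulmxK // mulmxK // !mul0mx => /eqP; rewrite subr_eq0 => /eqP S1.
  by apply: neqQ; rewrite Q2E -SS -S1 !mulmx1.
rewrite -subr_gt0; have : 0 < \tr (X ^t* *m X) by rewrite lt_def X0 normsq_mx_ge0.
by move=> /Rep_lt; rewrite XX -/(qtr k _) raddfB raddfD raddfMn.
Qed.

End MatrixPowers.

(** * Zariski closed sets and curves determined by their natural points *)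

Section PolynomialFunctions.
Variables (R : realType) (C : complexOver R).

(** The algebra generated by constants and entries, given inductively so that facts about polynomial
    functions are proved by induction on their construction. *)
Inductive polyfun n : ('M[C]_n -> C) -> Prop :=
| polyfun_const c : polyfun (fun=> c)
| polyfun_coord i j : polyfun (fun A => A i j)
| polyfun_add f g : polyfun f -> polyfun g -> polyfun (fun A => f A + g A)
| polyfun_mul f g : polyfun f -> polyfun g -> polyfun (fun A => f A * g A).

Definition zclosed n (G : set 'M[C]_n) : Prop := forall A,
  (forall f, polyfun f -> (forall B, G B -> f B = 0) -> f A = 0) -> G A.

Lemma polyfun_sum n I (r : seq I) (P : pred I) (f : I -> 'M[C]_n -> C) :
  (forall i, polyfun (f i)) -> polyfun (fun A => \sum_(i <- r | P i) f i A).
Proof.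
move=> pf; elim: r => [|i r IHr].
  by under eq_fun do rewrite big_nil; exact: polyfun_const.
under eq_fun do rewrite big_cons; case: (P i) => //.
exact: polyfun_add.
Qed.

Lemma polyfun_prod n I (r : seq I) (P : pred I) (f : I -> 'M[C]_n -> C) :
  (forall i, polyfun (f i)) -> polyfun (fun A => \prod_(i <- r | P i) f i A).
Proof.
move=> pf; elim: r => [|i r IHr].
  by under eq_fun do rewrite big_nil; exact: polyfun_const.
under eq_fun do rewrite big_cons; case: (P i) => //.
exact: polyfun_mul.
Qed.

Lemma polyfun_det n : polyfun (fun A : 'M[C]_n => \det A).
Proof.
apply: polyfun_sum => s; apply: polyfun_mul; first exact: polyfun_const.
by apply: polyfun_prod => i; exact: polyfun_coord.
Qed.

Lemma polyfun_comp m n (g : 'M[C]_m -> 'M[C]_n) (f : 'M[C]_n -> C) :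
  (forall i j, polyfun (fun A => g A i j)) -> polyfun f ->
  polyfun (fun A => f (g A)).
Proof.
move=> pg; elim=> [c|i j|f1 f2 _ h1 _ h2|f1 f2 _ h1 _ h2].
- exact: polyfun_const.
- exact: pg.
- exact: polyfun_add.
- exact: polyfun_mul.
Qed.

Lemma polyfun_conj n (g h : 'M[C]_n) (f : 'M[C]_n -> C) :
  polyfun f -> polyfun (fun A => f (g *m A *m h)).
Proof.
apply: polyfun_comp => i j; under eq_fun do rewrite mxE.
apply: polyfun_sum => k; apply: polyfun_mul; last exact: polyfun_const.
under eq_fun do rewrite mxE; apply: polyfun_sum => l.
by apply: polyfun_mul; [exact: polyfun_const|exact: polyfun_coord].
Qed.

(** The outer conjugation undoes the one inside [A ^t*], which leaves a polynomial with conjugated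
    coefficients. This is why the adjoint can be tested on a Zariski dense subset. *)
Lemma polyfun_adj n (f : 'M[C]_n -> C) :
  polyfun f -> polyfun (fun A => (f (A ^t*))^*).
Proof.
elim=> [c|i j|f1 f2 _ h1 _ h2|f1 f2 _ h1 _ h2].
- exact: polyfun_const.
- by under eq_fun do rewrite !mxE conjCK; exact: polyfun_coord.
- by under eq_fun do rewrite rmorphD; exact: polyfun_add.
- by under eq_fun do rewrite rmorphM; exact: polyfun_mul.
Qed.

Lemma polyfun_continuous n (f : 'M[C]_n -> C) : polyfun f -> continuous f.
Proof.
elim=> [c|i j|f1 f2 _ h1 _ h2|f1 f2 _ h1 _ h2] A.
- exact: cst_continuous.
- exact: coord_continuous.
- exact: (@cvgD _ _ _ (nbhs A) _ _ _ _ _ (h1 A) (h2 A)).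
- exact: (@cvgM _ _ (nbhs A) _ _ _ _ _ (h1 A) (h2 A)).
Qed.

Lemma zclosed_closed n (G : set 'M[C]_n) : zclosed G -> closed G.
Proof.
move=> zG.
have -> : G = \bigcap_(f in [set f | polyfun f /\ forall B, G B -> f B = 0])
    [set A | f A = 0].
  apply/seteqP; split=> [A GA f [_ f0]|A GA]; first exact: f0.
  by apply: zG => f pf f0; exact: GA.
by apply: closed_bigI => f [pf _]; apply: closed_eq0; exact: polyfun_continuous.
Qed.

Lemma zclosed_SL n : zclosed [set A : 'M[C]_n | \det A = 1].
Proof.
move=> A GA; apply/eqP; rewrite -subr_eq0; apply/eqP.
apply: (GA (fun A => \det A - 1)) => [|B /= ->]; last exact: subrr.
by apply: polyfun_add; [exact: polyfun_det|exact: polyfun_const].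
Qed.

(** An algebra of functions of a real variable that are determined by their values at the natural
    numbers. It is applied to [expsum] for powers of positive matrices and to [polycurve] for powers
    of unipotent ones. *)
Definition interpolation_class (E : set (R -> C)) : Prop :=
  [/\ forall c, E (fun=> c),
      forall f g, E f -> E g -> E (fun t => f t + g t),
      forall f g, E f -> E g -> E (fun t => f t * g t) &
      forall f, E f -> (forall k : nat, f k%:R = 0) -> forall t, f t = 0].

Lemma interpolation_sum (E : set (R -> C)) I (r : seq I) (f : I -> R -> C) :
  interpolation_class E -> (forall i, E (f i)) -> E (fun t => \sum_(i <- r) f i t).
Proof.
move=> [E0 ED _ _] Ef; elim: r => [|i r IHr].
  by under eq_fun do rewrite big_nil; exact: E0.
by under eq_fun do rewrite big_cons; exact: ED.
Qed.

Lemma zclosed_curve (E : set (R -> C)) n (G : set 'M[C]_n) (c : R -> 'M[C]_n) :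
  interpolation_class E -> (forall i j, E (fun t => c t i j)) ->
  zclosed G -> (forall k : nat, G (c k%:R)) -> forall t, G (c t).
Proof.
move=> [E0 ED EM Ev] Ec zG Gc t; apply: zG => f pf f0.
apply: (Ev (fun t => f (c t))) => [|k]; last exact/f0/Gc.
elim: pf => [a|i j|f1 f2 _ h1 _ h2|f1 f2 _ h1 _ h2].
- exact: E0.
- exact: Ec.
- exact: ED.
- exact: EM.
Qed.

Lemma interpolation_mx_eq (E : set (R -> C)) m n (c d : R -> 'M[C]_(m, n)) :
  interpolation_class E -> (forall i j, E (fun t => c t i j)) ->
  (forall i j, E (fun t => d t i j)) ->
  (forall k : nat, c k%:R = d k%:R) -> forall t, c t = d t.
Proof.
move=> [E0 ED EM Ev] Ec Ed cd t; apply/matrixP => i j; apply/eqP.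
rewrite -subr_eq0 -mulN1r; apply/eqP.
apply: (Ev (fun t => c t i j + -1 * d t i j)) => [|k]; last first.
  by rewrite cd mulN1r subrr.
by apply: ED => //; apply: EM => //; exact: E0.
Qed.

Lemma polynomial_interpolation (xs : seq C) (w : C -> C) :
  exists p : {poly C}, {in xs, forall x, p.[x] = w x}.
Proof.
elim: xs => [|x xs [p pE]]; first by exists 0.
have [xxs|xxs] := boolP (x \in xs).
  by exists p => y; rewrite inE => /orP[/eqP ->|]; exact: pE.
pose q := \prod_(y <- xs) ('X - y%:P).
have qx : q.[x] != 0 by rewrite -rootE root_prod_XsubC.
exists (p + ((w x - p.[x]) / q.[x])%:P * q) => y.
rewrite inE hornerD hornerM hornerC => /orP[/eqP ->|yxs].
  by rewrite divfK // addrC subrK.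
have /rootP -> : root q y by rewrite root_prod_XsubC.
by rewrite mulr0 addr0 pE.
Qed.

Definition expsum : set (R -> C) := [set f | exists s : seq (C * R),
  forall t, f t = \sum_(x <- s) x.1 * ofR (expR (t * x.2))].

Lemma expsum_class : interpolation_class expsum.
Proof.
split=> [c|f g [s fE] [r gE]|f g [s fE] [r gE]|f [s fE] f0 t].
- by exists [:: (c, 0)] => t; rewrite big_seq1 mulr0 expR0 rmorph1 mulr1.
- by exists (s ++ r) => t; rewrite big_cat /= fE gE.
- exists [seq (x.1 * y.1, x.2 + y.2) | x <- s, y <- r] => t.
  rewrite big_allpairs_dep fE gE mulr_suml; apply: eq_bigr => x _.
  rewrite mulr_sumr; apply: eq_bigr => y _ /=.
  by rewrite mulrDr expRD rmorphM mulrACA.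
(* A polynomial [p] sending [exp x] to [exp (t x)] for each of the finitely many exponents [x]
   writes [f t] as a linear combination, with the coefficients of [p], of the values [f k] at
   natural [k]. *)
pose z (x : C * R) : C := ofR (expR x.2).
have [p pE] := polynomial_interpolation [seq z x | x <- s]
  (fun u => ofR (expR (t * ln (Rep u)))).
have -> : f t = \sum_(x <- s) x.1 * p.[z x].
  rewrite fE !big_seq; apply: eq_bigr => x xs.
  by rewrite pE ?map_f // /z ofRK expRK.
under eq_bigr do rewrite horner_coef mulr_sumr.
rewrite exchange_big /= big1 // => k _.
under eq_bigr do rewrite mulrCA.
rewrite -mulr_sumr; suff -> : \sum_(x <- s) x.1 * z x ^+ k = f k%:R.
  by rewrite f0 mulr0.
by rewrite fE; apply: eq_bigr => x _; rewrite /z -rmorphXn -expRM_natl.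
Qed.

Definition polycurve : set (R -> C) := [set f | exists p : {poly C},
  forall t, f t = p.[ofR t]].

Lemma polycurve_class : interpolation_class polycurve.
Proof.
split=> [c|f g [p fE] [q gE]|f g [p fE] [q gE]|f [p fE] f0 t].
- by exists c%:P => t; rewrite hornerC.
- by exists (p + q) => t; rewrite hornerD fE gE.
- by exists (p * q) => t; rewrite hornerM fE gE.
rewrite fE; have [->|p0] := eqVneq p 0; first by rewrite horner0.
have := max_poly_roots (rs := [seq k%:R | k <- iota 0 (size p)]) p0.
rewrite size_map size_iota ltnn => H; suff : false by []; apply: H.
  by apply/allP => _ /mapP[k _ ->]; apply/rootP; rewrite -(f0 k) fE rmorph_nat.
rewrite map_inj_uniq ?iota_uniq // => i j /eqP; rewrite eqr_nat => /eqP; exact.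
Qed.

(** The entries of [mxpow P t] are exponential sums in [t], whose exponents are the logarithms of
    the eigenvalues of [P]. *)
Lemma zclosed_mxpow n (G : set 'M[C]_n) (P : 'M[C]_n) t :
  zclosed G -> (forall k, G (P ^+ k)) -> posdef P -> G (mxpow P t).
Proof.
move=> zG GX pP; apply: (zclosed_curve expsum_class _ zG) => [i j|k]; last first.
  by rewrite mxpow_nat.
rewrite /mxpow /eigexp; set U := (posdiag P).1; set l := (posdiag P).2.
under eq_fun do rewrite mxE.
apply: (interpolation_sum _ expsum_class) => k.
under eq_fun do rewrite mul_mx_ediag [in X in ofR X]mxE mulrAC.
exists [:: ((U ^t*) i k * U k j, l 0 k)] => s.
by rewrite big_seq1.
Qed.

End PolynomialFunctions.

(** * Convex energies on positive matrices and fixed points of compact groups *)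

Section FixedPoints.
Variables (R : realType) (C : complexOver R) (n : nat).
Implicit Types (G : set 'M[C]_n) (A B P Q s k : 'M[C]_n).

Record sl_group G : Prop := SlGroup {
  slg1 : G 1%:M;
  slgM : forall A B, G A -> G B -> G (A *m B);
  slgV : forall A, G A -> G (invmx A);
  slg_det : forall A, G A -> \det A = 1;
  slg_zclosed : zclosed G }.

Record selfadjoint_group G : Prop := SelfadjointGroup {
  sag_group :> sl_group G;
  sag_adj : forall A, G A -> G (A ^t*) }.

Lemma slg_unit G A : sl_group G -> G A -> A \in unitmx.
Proof. by move=> sG GA; rewrite unitmxE (slg_det sG GA) unitr1. Qed.

Lemma slgX G A j : sl_group G -> G A -> G (A ^+ j).
Proof.
move=> sG GA; elim: j => [|j IHj]; first exact: slg1 sG.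
by rewrite exprS; exact: (slgM sG GA IHj).
Qed.

Lemma slg_mxpow G P t : sl_group G -> G P -> posdef P -> G (mxpow P t).
Proof.
by move=> sG GP; apply: zclosed_mxpow (slg_zclosed sG) (fun j => slgX j sG GP).
Qed.

Lemma selfadjoint_SL : selfadjoint_group [set A : 'M[C]_n | \det A = 1].
Proof.
split; last by move=> A /= dA; rewrite det_trmxC dA rmorph1.
split=> //=.
- exact: det1.
- by move=> A B /= dA dB; rewrite det_mulmx dA dB mulr1.
- by move=> A /= dA; rewrite det_inv dA invr1.
- exact: zclosed_SL.
Qed.

Lemma qtr_conj k A Q : qtr k (A ^t* *m Q *m A) = qtr (A *m k) Q.
Proof. by rewrite /qtr trmxC_mul !mulmxA. Qed.

Lemma qtr1 Q : qtr 1%:M Q = Rep (\tr Q).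
Proof. by rewrite /qtr trmxC1 mul1mx mulmx1. Qed.

Lemma qtr_ge0 k Q : posdef Q -> 0 <= qtr k Q.
Proof.
move=> pQ; apply: Rep_ge0; rewrite -(mxpow_half pQ).
have := posdef_herm (mxpow_posdef 2^-1 pQ); set A := mxpow Q _ => Ah.
have -> : k ^t* *m (A *m A) *m k = (A *m k) ^t* *m (A *m k).
  by rewrite trmxC_mul Ah !mulmxA.
exact: normsq_mx_ge0.
Qed.

Lemma qtr_unitary k Q : k \is unitarymx -> qtr k Q = Rep (\tr Q).
Proof.
by move=> uk; rewrite /qtr mxtrace_mulC mulmxA (unitarymxK uk).1 mul1mx.
Qed.

Lemma cvg_qtr T (F : set_system T) {FF : Filter F} (f g : T -> 'M[C]_n) k Q :
  f @ F --> k -> g @ F --> Q -> qtr (f x) (g x) @[x --> F] --> qtr k Q.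
Proof.
move=> fk gQ; apply: cvg_Rep_tr; apply: cvg_mulmx => //.
by apply: cvg_mulmx => //; exact: cvg_trmxC.
Qed.

(** For a selfadjoint [G] this is a model of its symmetric space, on which [A] acts by
    [Q |-> A^* Q A]. *)
Definition posdef_in G : set 'M[C]_n := [set Q | G Q /\ posdef Q].

(** Semidefiniteness is a closed condition, invertibility is not; inside [G] the latter comes from
    determinant 1. *)
Lemma closed_posdef_in G : sl_group G -> closed (posdef_in G).
Proof.
move=> sG; have -> : posdef_in G = G `&` ([set Q | Q ^t* = Q] `&`
    \bigcap_(v in @setT 'rV[C]_n) [set Q | 0 <= (v *m Q *m v ^t*) 0 0]).
  apply/seteqP; split=> Q /=.
    by move=> [GQ [[Qh Q0] _]]; split=> //; split=> // v _; exact: Q0.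
  move=> [GQ [Qh Q0]]; split=> //; split; last exact: slg_unit sG GQ.
  by split=> // v; exact: Q0.
apply: closedI; first exact: (zclosed_closed (slg_zclosed sG)).
apply: closedI.
  apply: closed_eqmx => Q; last exact: cvg_id.
  by apply: (@cvg_trmxC _ _ _ (nbhs Q)); exact: cvg_id.
apply: closed_bigI => v _.
apply: (@closed_comp _ _ (fun Q : 'M[C]_n => (v *m Q *m v ^t*) 0 0)
  [set z : C | 0 <= z]); last exact: closed_ge0C.
move=> Q _; apply: (@cvg_mx_coord _ _ (nbhs Q)).
by do 2![apply: (@cvg_mulmx _ _ (nbhs Q)); try exact: cvg_cst]; exact: cvg_id.
Qed.

Lemma compact_posdef_in G (c : R) : sl_group G ->
  compact (posdef_in G `&` [set Q | Rep (\tr Q) <= c]).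
Proof.
move=> sG; apply: (@closed_bounded_compact _ _ _ _ _ c).
  apply: closedI; first exact: closed_posdef_in.
  apply: (@closed_comp _ _ (fun Q : 'M[C]_n => Rep (\tr Q)) [set x | x <= c]).
    by move=> Q _; apply: (@cvg_Rep_tr _ _ _ (nbhs Q)); exact: cvg_id.
  exact: closed_le.
move=> Q [[_ pQ] Qc] i j; apply: le_trans (posdef_entry _ _ pQ) _.
by rewrite ler_ofR.
Qed.

Lemma mxmid_in G Q1 Q2 : sl_group G ->
  posdef_in G Q1 -> posdef_in G Q2 -> posdef_in G (mxmid Q1 Q2).
Proof.
move=> sG [G1 p1] [G2 p2]; split; last exact: mxmid_posdef.
have GA := slg_mxpow 2^-1 sG G1 p1; have pA := mxpow_posdef 2^-1 p1.
rewrite /mxmid /=; set A := mxpow Q1 _ in GA pA *.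
have GAV := slgV sG GA.
apply: (slgM sG) => //; apply: (slgM sG) => //; apply: (slg_mxpow _ sG).
  by apply: (slgM sG) => //; exact: (slgM sG).
by apply: posdef_conj_herm => //; rewrite ?trmxC_inv ?(posdef_herm pA) // unitmx_inv (posdef_unit pA).
Qed.

(** Closed sublevel sets that are dominated by the trace are compact, which gives a minimum;
    strictness at midpoints makes it unique. The bound by the maximum, rather than by the mean,
    passes directly to an attained supremum of energies. *)
Definition mid_convex G (F : 'M[C]_n -> R) : Prop :=
  [/\ forall c, closed [set Q | F Q <= c],
      forall Q, posdef_in G Q -> Rep (\tr Q) <= F Q &
      forall Q1 Q2, posdef_in G Q1 -> posdef_in G Q2 -> Q1 <> Q2 ->
        F (mxmid Q1 Q2) < Num.max (F Q1) (F Q2)].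

Definition minimizer G (F : 'M[C]_n -> R) Q : Prop :=
  posdef_in G Q /\ forall Q', posdef_in G Q' -> F Q <= F Q'.

Lemma minimizer_unique G F Q1 Q2 : sl_group G -> mid_convex G F ->
  minimizer G F Q1 -> minimizer G F Q2 -> Q1 = Q2.
Proof.
move=> sG [_ _ Fmid] [p1 min1] [p2 min2]; apply: contrapT => neqQ.
have := Fmid _ _ p1 p2 neqQ; have pm := mxmid_in sG p1 p2.
by rewrite lt_max ltNge min1 // ltNge min2.
Qed.

Lemma minimizer_exists G F : sl_group G -> mid_convex G F ->
  exists Q, minimizer G F Q.
Proof.
move=> sG [Fcl Ftr _].
have p1 : posdef_in G 1%:M by split; [exact: slg1|exact: posdef1].
pose V := [set F Q | Q in posdef_in G].
have infV : has_inf V.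
  split; first by exists (F 1%:M), 1%:M.
  exists 0 => _ [Q pQ <-]; apply: le_trans (Ftr _ pQ).
  by rewrite -qtr1; exact: qtr_ge0 pQ.2.
pose L c := posdef_in G `&` [set Q | F Q <= c].
have clL c : closed (L c) by apply: closedI => //; exact: closed_posdef_in.
have cL c : compact (L c).
  apply: (subclosed_compact (clL c) (compact_posdef_in (c := c) sG)) => Q [pQ Qc].
  by split=> //; apply: le_trans (Ftr _ pQ) Qc.
have LS c d : c <= d -> L c `<=` L d.
  by move=> cd Q [pQ Qc]; split=> //; exact: le_trans Qc cd.
(* The nonempty sublevel sets at heights [inf V + e] generate a proper filter; a cluster point lies
   in each of them because they are closed. *)
pose FF := filter_from [set e : R | 0 < e] (fun e => L (inf V + e)).
have PF : ProperFilter FF.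
  apply: filter_from_proper.
    apply: filter_from_filter; first by exists 1 => /=.
    move=> e d e0 d0; exists (Num.min e d) => /=; first by rewrite lt_min e0.
    move=> Q LQ; split; apply: LS LQ; rewrite lerD2l.
      by rewrite ge_min lexx.
    by rewrite ge_min lexx orbT.
  move=> e e0; have [_ [Q pQ <-] QV] := inf_adherent e0 infV.
  by exists Q; split=> //; exact: ltW.
have [Q [LQ clQ]] := cL (inf V + 1) FF PF (ex_intro2 _ _ 1 ltr01 (fun x H => H)).
exists Q; split=> [|Q' pQ']; first exact: LQ.1.
apply: (@le_trans _ _ (inf V)); last by apply: ge_inf; [exact: infV.2|exists Q'].
apply/ler_addgt0Pr => e e0.
have : closure (L (inf V + e)) Q.
  by move=> U UQ; apply: clQ => //; exists e.
by rewrite -(closure_id _).1 //; case.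
Qed.

(** The action of [A] preserves both [posdef_in G] and [F], so it maps a minimizer to a minimizer,
    and there is only one. *)
Lemma minimizer_fixed G F (A : 'M[C]_n) Q : selfadjoint_group G ->
  mid_convex G F -> G A ->
  (forall P, posdef P -> F (A ^t* *m P *m A) = F P) ->
  minimizer G F Q -> A ^t* *m Q *m A = Q.
Proof.
move=> sG cF GA FA mQ; apply: (minimizer_unique sG cF) (mQ).
have [[GQ pQ] minQ] := mQ; split=> [|Q' pQ']; last by rewrite FA // minQ.
split; last exact: posdef_conj (slg_unit sG GA) pQ.
by apply: (slgM sG) => //; apply: (slgM sG) => //; exact: sag_adj.
Qed.

Lemma compact_fixed_point G K : selfadjoint_group G -> K `<=` G ->
  compact K -> K 1%:M -> (forall A B, K A -> K B -> K (A *m B)) ->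
  (forall A, K A -> K (invmx A)) ->
  exists2 Q, posdef_in G Q & forall k, K k -> k ^t* *m Q *m k = Q.
Proof.
move=> sG KG cK K1 KM KV.
(* [kap Q] is a point of the compact group where [qtr _ Q] is largest, so that [F] below is the
   supremum of the energies over [K]. *)
have /choice[kap kapP] : forall Q, exists k, K k /\ forall h, K h -> qtr h Q <= qtr k Q.
  move=> Q; have [k] := @compact_EVT_max _ R (fun k => qtr k Q) K (ex_intro _ _ K1) cK
    (continuous_subspaceT (fun k => @cvg_qtr _ (nbhs k) _ _ _ _ _ (@cvg_id _ _) (@cvg_cst _ _ _ _ _))).
  by rewrite inE => Kk kmax; exists k; split=> // h Kh; apply: kmax; rewrite inE.
pose F Q := qtr (kap Q) Q.
have cF : mid_convex G F.
  split=> [c|Q pQ|Q1 Q2 p1 p2 neqQ].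
  (* A supremum of continuous functions has closed sublevel sets. *)
  - have -> : [set Q | F Q <= c] = \bigcap_(k in K) [set Q | qtr k Q <= c].
      apply/seteqP; split=> Q /= FQ; last by apply: FQ; case: (kapP Q).
      by move=> k Kk; apply: le_trans FQ; case: (kapP Q) => _; exact.
    apply: closed_bigI => k _.
    apply: (@closed_comp _ _ (fun Q : 'M[C]_n => qtr k Q) [set x | x <= c]).
      by move=> Q _; apply: (@cvg_qtr _ (nbhs Q)); [exact: cvg_cst|exact: cvg_id].
    exact: closed_le.
  - by rewrite -qtr1; case: (kapP Q) => _; exact.
  (* Strictness survives the supremum because it is attained: the inequality at the single point
     [kap Qm] already bounds [F Qm]. *)
  - set Qm := mxmid Q1 Q2; have [Kk _] := kapP Qm.
    have := mxmid_lt p1.2 p2.2 neqQ (slg_unit sG (KG _ Kk)).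
    rewrite -/Qm -/(F Qm) => H.
    have h1 : qtr (kap Qm) Q1 <= F Q1 by case: (kapP Q1) => _; exact.
    have h2 : qtr (kap Qm) Q2 <= F Q2 by case: (kapP Q2) => _; exact.
    by rewrite lt_max; case: (ltP (F Qm) (F Q1)) => //= ?; move: H; rewrite mulr2n => H; lra.
have [Q mQ] := minimizer_exists sG cF; exists Q; first exact: mQ.1.
move=> A KA; apply: (minimizer_fixed sG cF) (mQ); first exact: KG.
move=> P pP; have uA := slg_unit sG (KG _ KA).
apply/eqP; rewrite eq_le; apply/andP; split.
  rewrite /F qtr_conj; have [_] := kapP P; apply; apply: KM => //.
  by case: (kapP (A ^t* *m P *m A)).
have [Kk kmax] := kapP (A ^t* *m P *m A).
rewrite /F; have := kmax (invmx A *m kap P); rewrite qtr_conj mulKVmx //; apply.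
by apply: KM; [exact: KV|case: (kapP P)].
Qed.

(** * The energy of a matrix of finite order and its minimum *)

Section FiniteOrder.
Variable M : nat.

(** The number of terms does not depend on [s], which makes the energy jointly continuous. When
    [s ^+ M = 1%:M], multiplication by [s] permutes the terms and the energy is invariant under
    [s]. *)
Definition cyc_energy s Q : R := \sum_(j < M) qtr (s ^+ j) Q.

Lemma cvg_cyc_energy T (F : set_system T) {FF : Filter F} (f g : T -> 'M[C]_n) s Q :
  f @ F --> s -> g @ F --> Q ->
  cyc_energy (f x) (g x) @[x --> F] --> cyc_energy s Q.
Proof.
move=> fs gQ; apply: cvg_sumr => j; apply: cvg_qtr => //; exact: cvg_expmx.
Qed.

Lemma cyc_energy_tr s Q : (0 < M)%N -> posdef Q -> Rep (\tr Q) <= cyc_energy s Q.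
Proof.
move=> M0 pQ; rewrite /cyc_energy (bigD1 (Ordinal M0)) //= expr0 -qtr1 lerDl.
by apply: sumr_ge0 => j _; exact: qtr_ge0.
Qed.

Lemma cyc_energy_convex G s : sl_group G -> G s -> (0 < M)%N ->
  mid_convex G (cyc_energy s).
Proof.
move=> sG Gs M0; split=> [c|Q [_ pQ]|Q1 Q2 p1 p2 neqQ].
- apply: (@closed_comp _ _ (cyc_energy s) [set x | x <= c]).
    by move=> Q _; apply: (@cvg_cyc_energy _ (nbhs Q)); [exact: cvg_cst|exact: cvg_id].
  exact: closed_le.
- exact: cyc_energy_tr.
- have : cyc_energy s (mxmid Q1 Q2) *+ 2 < cyc_energy s Q1 + cyc_energy s Q2.
    rewrite /cyc_energy -sumrMnl -big_split /=; apply: ltr_sum.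
      by apply/hasP; exists (Ordinal M0); rewrite ?mem_index_enum.
    move=> j _; apply: mxmid_lt => //; [exact: p1.2|exact: p2.2|].
    exact: slg_unit sG (slgX j sG Gs).
  rewrite lt_max mulr2n => H; case: ltP => //= ?; lra.
Qed.

Lemma mulmxX A j : A *m A ^+ j = A ^+ j.+1.
Proof. by rewrite exprS. Qed.

Lemma cyc_energy_conj s Q : s ^+ M = 1%:M ->
  cyc_energy s (s ^t* *m Q *m s) = cyc_energy s Q.
Proof.
move=> sM; rewrite /cyc_energy; under eq_bigr do rewrite qtr_conj mulmxX.
case: M sM => [|m] sM; first by rewrite !big_ord0.
by rewrite big_ord_recr big_ord_recl /= sM expr0 addrC.
Qed.

Definition cyc_center G s : 'M[C]_n := xget 1%:M (minimizer G (cyc_energy s)).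

Lemma cyc_centerP G s : sl_group G -> G s -> (0 < M)%N ->
  minimizer G (cyc_energy s) (cyc_center G s).
Proof.
move=> sG Gs M0; have [Q mQ] := minimizer_exists sG (cyc_energy_convex sG Gs M0).
by rewrite /cyc_center; case: xgetP => [Q' -> //|/(_ Q)].
Qed.

Lemma cyc_center_fixed G s : selfadjoint_group G -> G s -> (0 < M)%N ->
  s ^+ M = 1%:M -> s ^t* *m cyc_center G s *m s = cyc_center G s.
Proof.
move=> sG Gs M0 sM; apply: (minimizer_fixed sG (cyc_energy_convex sG Gs M0) Gs) => [P _|].
  exact: cyc_energy_conj.
exact: (cyc_centerP sG Gs M0).
Qed.

(** For unitary [s] the energy is [M] times the trace. On matrices of determinant 1 the logarithms
    of the eigenvalues sum to 0, so [1 + x <= exp x] shows that the trace is least at the identity.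
    Hence the conjugation by powers of the center does not move pairs with unitary [s]. *)
Lemma cyc_center_unitary G s : sl_group G -> G s -> (0 < M)%N ->
  s \is unitarymx -> cyc_center G s = 1%:M.
Proof.
move=> sG Gs M0 us; apply: (minimizer_unique sG (cyc_energy_convex sG Gs M0)).
  exact: (cyc_centerP sG Gs M0).
have usX j : s ^+ j \is unitarymx.
  elim: j => [|j IHj]; first by apply/unitarymxP; rewrite trmxC1 mulmx1.
  by rewrite exprS; exact: mul_unitarymx.
have FE Q : cyc_energy s Q = Rep (\tr Q) *+ M.
  rewrite /cyc_energy; under eq_bigr do rewrite qtr_unitary //.
  by rewrite sumr_const card_ord.
split; first by split; [exact: slg1|exact: posdef1].
move=> Q [GQ /posdef_eigexp[[U l] [/= uU QE]]]; rewrite !FE lerMn2r.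
apply/orP; right; rewrite QE eigexp_trace // ofRK.
have l0 : \sum_i l 0 i = 0.
  have := slg_det sG GQ; rewrite QE eigexp_det // -(rmorph1 (@ofR R C)).
  by move=> /ofR_inj; rewrite -expR0 => /expR_inj.
have -> : Rep (\tr (1%:M : 'M[C]_n)) = \sum_(i < n) (1 + l 0 i).
  rewrite big_split /= l0 addr0 sumr_const card_ord mxtrace1.
  by rewrite -(rmorph_nat (@ofR R C)) ofRK.
by apply: ler_sum => i _; exact: expR_ge1Dx.
Qed.

(** The closed graph principle: being a minimizer for [s] is a closed condition on [(s, Q)] that
    determines [Q], and the trace of the minimizer is bounded by the energy of the identity, which
    is locally bounded in [s]. *)
Lemma cyc_center_continuous G : sl_group G -> (0 < M)%N ->
  {within G, continuous (cyc_center G)}.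
Proof.
move=> sG M0.
pose S : set ('M[C]_n * 'M[C]_n) := [set w | posdef_in G w.2] `&`
  \bigcap_(Q in posdef_in G) [set w | cyc_energy w.1 w.2 - cyc_energy w.1 Q <= 0].
apply: (@closed_graph_continuous _ _ _ _ _ (cyc_center G) snd S).
- apply: closedI.
    apply: (@closed_comp _ _ snd (posdef_in G)) (closed_posdef_in sG).
    by move=> w _; exact: cvg_snd.
  apply: closed_bigI => Q _.
  apply: (@closed_comp _ _ (fun w => cyc_energy w.1 w.2 - cyc_energy w.1 Q)
    [set x | x <= 0]); last exact: closed_le.
  move=> w _; apply: (@cvgB _ _ _ (nbhs w)).
    by apply: (@cvg_cyc_energy _ (nbhs w)); [exact: cvg_fst|exact: cvg_snd].
  by apply: (@cvg_cyc_energy _ (nbhs w)); [exact: cvg_fst|exact: cvg_cst].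
- move=> s Gs; have [pQ minQ] := cyc_centerP sG Gs M0; split=> // Q pQ' /=.
  by rewrite subr_le0 minQ.
- by [].
- move=> s Q Gs [/= pQ minQ].
  apply: (minimizer_unique sG (cyc_energy_convex sG Gs M0)) (cyc_centerP sG Gs M0).
  by split=> // Q' pQ'; have := minQ Q' pQ'; rewrite /= subr_le0.
- by move=> s Q _ _; exact: cvg_snd.
move=> s Gs; pose c := cyc_energy s 1%:M + 1.
exists (posdef_in G `&` [set Q | Rep (\tr Q) <= c]); first exact: compact_posdef_in.
have : \forall s' \near nbhs s, cyc_energy s' 1%:M < c.
  apply: (@cvgr_lt _ _ (nbhs s) _ (fun s' => cyc_energy s' 1%:M) (cyc_energy s 1%:M)).
    by apply: (@cvg_cyc_energy _ (nbhs s)); [exact: cvg_id|exact: cvg_cst].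
  by rewrite /c ltrDl.
rewrite /within /=; apply: filterS => s' s'c Gs'.
have [pQ minQ] := cyc_centerP sG Gs' M0; split=> //=.
apply: le_trans (cyc_energy_tr s' M0 pQ.2) _; apply: le_trans (ltW s'c).
by apply: minQ; split; [exact: slg1|exact: posdef1].
Qed.

End FiniteOrder.
End FixedPoints.

(** * Integer powers and intertwining relations *)

Section IntegerPowers.
Variables (C : fieldType) (n : nat).
Implicit Types (A B X : 'M[C]_n) (z p q : int).

Definition mxz A z : 'M[C]_n :=
  match z with Posz k => A ^+ k | Negz k => invmx (A ^+ k.+1) end.

Lemma unitmxX A j : A \in unitmx -> A ^+ j \in unitmx.
Proof.
move=> uA; elim: j => [|j IHj]; first exact: unitmx1.
by rewrite exprS [_ \in _]unitmx_mul uA.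
Qed.

Lemma mxz_unit A z : A \in unitmx -> mxz A z \in unitmx.
Proof. by case: z => j uA /=; rewrite ?unitmx_inv unitmxX. Qed.

Lemma comm_mxX A B j : A *m B = B *m A -> A *m B ^+ j = B ^+ j *m A.
Proof.
move=> AB; elim: j => [|j IHj]; first by rewrite expr0 mulmx1 mul1mx.
by rewrite exprS mulmxA AB -!mulmxA IHj.
Qed.

Lemma intertwine_inv X A B : A \in unitmx -> B \in unitmx ->
  X *m A = B *m X -> X *m invmx A = invmx B *m X.
Proof. by move=> uA uB XA; rewrite -[LHS](mulKmx uB) (mulmxA B) -XA mulmxK. Qed.

Lemma intertwineX X A B j : X *m A = B *m X -> X *m A ^+ j = B ^+ j *m X.
Proof.
move=> XA; elim: j => [|j IHj]; first by rewrite !expr0 mulmx1 mul1mx.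
by rewrite !exprS mulmxA XA -mulmxA IHj mulmxA.
Qed.

Lemma intertwine_mxz X A B z : A \in unitmx -> B \in unitmx ->
  X *m A = B *m X -> X *m mxz A z = mxz B z *m X.
Proof.
case: z => j uA uB XA /=; first exact: intertwineX.
by apply: intertwine_inv; [exact: unitmxX|exact: unitmxX|exact: intertwineX].
Qed.

Lemma expmxM A j k : A ^+ (j * k) = (A ^+ j) ^+ k.
Proof. exact: exprM. Qed.

Lemma invmxX A j : A \in unitmx -> invmx A ^+ j = invmx (A ^+ j).
Proof.
move=> uA; have VA : invmx A ^+ j *m A ^+ j = 1%:M.
  have cVA : GRing.comm (invmx A) A.
    by rewrite /GRing.comm [LHS](mulVmx uA) [RHS](mulmxV uA).
  rewrite -[LHS](exprMn_comm j cVA) (_ : _ * A = 1%:M); first exact: expr1n.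
  exact: mulVmx.
by rewrite -[LHS](mulmxK (unitmxX j uA)) VA mul1mx.
Qed.

Lemma mxzX A z j : A \in unitmx -> mxz (A ^+ j) z = mxz A z ^+ j.
Proof.
move=> uA; case: z => k /=; first by rewrite -!expmxM mulnC.
by rewrite invmxX ?unitmxX // -!expmxM mulnC.
Qed.

Lemma mxz_inv A z : A \in unitmx -> mxz (invmx A) z = invmx (mxz A z).
Proof. by move=> uA; case: z => k /=; rewrite invmxX. Qed.

Lemma mxzC A p q : A \in unitmx -> mxz (mxz A p) q = mxz (mxz A q) p.
Proof.
move=> uA; case: p => j; first by rewrite [mxz A j]/= mxzX.
by rewrite [mxz A (Negz j)]/= mxz_inv ?unitmxX // mxzX.
Qed.

Lemma mxz_sq A p : A \in unitmx -> mxz (mxz A p) p = A ^+ (`|p| ^ 2).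
Proof.
move=> uA; case: p => j /=; first by rewrite -expmxM expnS expn1.
by rewrite invmxX ?unitmxX // invmxK -expmxM expnS expn1.
Qed.

Lemma mxzM A B z : A \in unitmx -> B \in unitmx -> A *m B = B *m A ->
  mxz (A *m B) z = mxz A z *m mxz B z.
Proof.
move=> uA uB AB.
have XM j : (A *m B) ^+ j = A ^+ j *m B ^+ j by exact: exprMn_comm.
case: z => j /=; rewrite XM //; set k := j.+1.
have uAk := unitmxX k uA; have uBk := unitmxX k uB.
have ABk : A ^+ k *m B ^+ k = B ^+ k *m A ^+ k.
  by apply: comm_mxX; apply/esym; apply: comm_mxX.
have uABk : A ^+ k *m B ^+ k \in unitmx by rewrite unitmx_mul uAk.
rewrite -[RHS](mulmxK uABk) [X in _ = _ *m X *m _]ABk -(mulmxA (invmx _)) (mulKmx uBk).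
by rewrite mulVmx // mul1mx.
Qed.

End IntegerPowers.

(** * Eigenvalues under a relation between powers *)

Section Spectrum.
Variables (C : numClosedFieldType).

Lemma char_poly_similar n (P A B : 'M[C]_n) : P \in unitmx ->
  P *m A = B *m P -> char_poly A = char_poly B.
Proof.
move=> uP PA; have dP : (\det P)%:P != 0 :> {poly C}.
  by rewrite polyC_eq0 -unitfE -unitmxE.
apply: (mulfI dP); rewrite [RHS]mulrC /char_poly -det_map_mx -!det_mulmx.
congr (\det _); rewrite /char_poly_mx mulmxBr mulmxBl -!map_mxM PA.
by rewrite scalar_mxC.
Qed.

Lemma trigX n (T : 'M[C]_n) j : is_trig_mx T ->
  is_trig_mx (T ^+ j) /\ forall i, (T ^+ j) i i = T i i ^+ j.
Proof.
move=> /is_trig_mxP tT; elim: j => [|j [/is_trig_mxP tX dX]].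
  by split=> [|i]; [exact: scalar_mx_is_trig|rewrite !expr0 mxE eqxx].
rewrite exprS; split=> [|i].
  apply/is_trig_mxP => i k ik; rewrite mxE big1 // => l _.
  case: (ltnP i l) => il; first by rewrite tT // mul0r.
  by rewrite tX ?mulr0 // (leq_ltn_trans il).
rewrite mxE (bigD1 i) //= big1 ?addr0 ?dX ?exprS // => l li.
case: (ltngtP i l) => il; first by rewrite tT // mul0r.
  by rewrite tX // mulr0.
by move: li; rewrite (val_inj il) eqxx.
Qed.

(** The absolute difference of [a ^ n!] and [b ^ n!] in natural numbers: one of the two truncated
    differences is 0. *)
Definition bs_period (n a b : nat) : nat :=
  ((a ^ n`! - b ^ n`!) + (b ^ n`! - a ^ n`!))%N.

Lemma bs_period_gt0 n a b : a <> b -> (0 < bs_period n a b)%N.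
Proof.
move=> /eqP ab; rewrite /bs_period addn_gt0 !subn_gt0 !ltn_exp2r ?fact_gt0 //.
by rewrite -neq_ltn eq_sym.
Qed.

(** Modulo a divisor of [a] the period is [b ^ n!] up to sign, so a common divisor of [a] and the
    period divides [b ^ n!]. *)
Lemma bs_period_coprime n a b : coprime a b -> coprime a (bs_period n a b).
Proof.
move=> cab; set d := gcdn a (bs_period n a b).
have dM : (d %| bs_period n a b)%N by exact: dvdn_gcdr.
have dX : (d %| a ^ n`!)%N by rewrite dvdn_exp ?fact_gt0 ?dvdn_gcdl.
have dbX : (d %| b ^ n`!)%N.
  move: dM; rewrite /bs_period; case: (leqP (a ^ n`!) (b ^ n`!)) => ab.
    by rewrite (eqP ab) add0n => H; rewrite -(subnKC ab) dvdn_add.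
  by rewrite (eqP (ltnW ab)) addn0 dvdn_subr // ltnW.
rewrite /coprime -dvdn1 -(eqP (coprimeXr n`! cab)) dvdn_gcd dbX.
by rewrite dvdn_gcdl.
Qed.

(* A [C]-linear relation [X y^a = y^b X] permutes the eigenvalues [l_i] so that
   [l_i^a = l_(s i)^b]; since [s] has order dividing [n!], all [l_i] are roots
   of unity of order dividing [a^(n!) - b^(n!)]. *)
Lemma bs_unipotent n a b (X y : 'M[C]_n) : X \in unitmx -> y \in unitmx ->
  X *m y ^+ a = y ^+ b *m X -> (y ^+ bs_period n a b - 1%:M) ^+ n = 0.
Proof.
case: n X y => [|n] X y uX uy Xy; first by apply/matrixP => -[].
have [P uP tT] := Schur y (ltn0Sn n).
have {}uP := unitarymx_unit uP.
set T := conjmx P y in tT.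
have PT j : P *m y ^+ j = T ^+ j *m P.
  by apply: intertwineX; rewrite /T conjumx // mulmxKV.
have cpE j : char_poly (y ^+ j) = \prod_(x <- [seq T i i ^+ j | i <- enum 'I_n.+1]) ('X - x%:P).
  rewrite (char_poly_similar uP (PT j)) big_map big_enum /=.
  have [tX dX] := trigX j tT; rewrite (char_poly_trig tX).
  by apply: eq_bigr => i _; rewrite dX.
(* The characteristic polynomials of [y ^+ a] and [y ^+ b] agree, and comparing their linear factors
   yields the permutation [s]. *)
have := char_poly_similar uX Xy; rewrite !cpE => /prod_XsubC_eq.
pose t c := [tuple T i i ^+ c | i < n.+1].
rewrite -[X in perm_eq _ X]/(tval (t b)) => /tuple_permP[s sE].
have lE i : T i i ^+ a = T (s i) (s i) ^+ b.
  have /(congr1 (fun r => nth 0 r i)) := sE.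
  rewrite (nth_map i) ?size_enum_ord // nth_ord_enum => ->.
  by rewrite -tnth_nth tnth_mktuple tnth_mktuple.
have lX k i : T i i ^+ (a ^ k) = T ((s ^+ k)%g i) ((s ^+ k)%g i) ^+ (b ^ k).
  elim: k i => [|k IHk] i; first by rewrite expg0 perm1 !expn0.
  by rewrite expnSr exprM IHk -exprM mulnC exprM lE -exprM -expnS expgSr permM.
have l0 i : T i i != 0.
  have : T \in unitmx by rewrite /T conjumx // !unitmx_mul uP uy unitmx_inv.
  by rewrite unitmxE (det_trig tT) unitfE => /prodf_neq0; exact.
have lM i : T i i ^+ bs_period n.+1 a b = 1.
  have sN : (s ^+ (n.+1)`!)%g = 1%g.
    by rewrite -[(n.+1)`!]card_Sn -cardsT expg_cardG // inE.
  have := lX (n.+1)`! i; rewrite sN perm1 /bs_period => lab.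
  have E u v : (u <= v)%N -> T i i ^+ u = T i i ^+ v -> T i i ^+ ((u - v) + (v - u)) = 1.
    move=> uv Euv; rewrite (eqP uv) add0n; apply: (mulIf (expf_neq0 u (l0 i))).
    by rewrite -exprD subnK // mul1r.
  case: (leqP (a ^ (n.+1)`!) (b ^ (n.+1)`!)) => [|/ltnW] ab; first exact: E.
  by rewrite addnC; exact: E.
(* All eigenvalues of this power are 1, so its characteristic polynomial is a power of ['X - 1]. *)
have := Cayley_Hamilton (y ^+ bs_period n.+1 a b); rewrite cpE.
have -> : \prod_(x <- [seq T i i ^+ bs_period n.+1 a b | i <- enum 'I_n.+1])
    ('X - x%:P) = ('X - 1%:P) ^+ n.+1 :> {poly C}.
  rewrite big_map big_enum /=; under eq_bigr do rewrite lM.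
  by rewrite prodr_const card_ord.
by rewrite rmorphXn rmorphB /= horner_mx_X horner_mx_C.
Qed.

End Spectrum.

(** * Real powers of unipotent matrices *)

Section UnipotentPowers.
Variables (R : realType) (C : complexOver R).

(** The binomial coefficient ['X] over [k] as a polynomial. *)
Definition binc (k : nat) : {poly C} :=
  (k`!%:R)^-1 *: \prod_(i < k) ('X - (i%:R)%:P).

Lemma binc_nat k (m : nat) : (binc k).[m%:R] = 'C(m, k)%:R.
Proof.
have fact0 : k`!%:R != 0 :> C by rewrite pnatr_eq0 -lt0n fact_gt0.
rewrite /binc hornerZ; apply: (mulfI fact0); rewrite mulVKf //.
rewrite -natrM mulnC bin_ffact horner_prod.
elim: k {fact0} => [|k IHk]; first by rewrite big_ord0 ffactn0.
rewrite big_ord_recr /= IHk ffactnSr natrM !hornerE.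
case: (leqP k m) => km; first by rewrite natrB.
by rewrite ffact_small // !mul0r.
Qed.

(** The binomial series of [(1 + N)^t] for [N = z - 1], cut off at [n] since [N ^+ n = 0] for
    unipotent [z]. As a polynomial expression in [z] and [t] it is continuous on all matrices. *)
Definition upow n (z : 'M[C]_n) (t : R) : 'M[C]_n :=
  \sum_(k < n) (binc k).[ofR t] *: (z - 1%:M) ^+ k.

Definition unipotent n (z : 'M[C]_n) : Prop := (z - 1%:M) ^+ n = 0.

(** The factor [c] serves the exponents [p t] and [q t] of the deformed relation. *)
Lemma upow_polycurve n (z : 'M[C]_n) (c : R) i j :
  @polycurve R C (fun t => upow z (c * t) i j).
Proof.
rewrite /upow; under eq_fun do rewrite summxE.
apply: (interpolation_sum _ (@polycurve_class R C)) => k.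
exists ((((z - 1%:M) ^+ k) i j)%:P * (binc k \Po ((ofR c)%:P * 'X))) => t.
rewrite mxE hornerM hornerC horner_comp.
have -> : ((ofR c)%:P * 'X).[ofR t] = ofR (c * t) :> C.
  by rewrite hornerM hornerC hornerX rmorphM.
exact: mulrC.
Qed.

Lemma upow_polycurve1 n (z : 'M[C]_n) i j :
  @polycurve R C (fun t => upow z t i j).
Proof. by have := upow_polycurve z 1 i j; under eq_fun do rewrite mul1r. Qed.

Lemma polycurve_cst (c : C) : @polycurve R C (fun=> c).
Proof. by case: (@polycurve_class R C). Qed.

Lemma polycurve_mulmx m n p (c : R -> 'M[C]_(m, n)) (d : R -> 'M[C]_(n, p)) :
  (forall i j, polycurve (fun t => c t i j)) ->
  (forall i j, polycurve (fun t => d t i j)) ->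
  forall i j, polycurve (fun t => (c t *m d t) i j).
Proof.
move=> pc pd i j; under eq_fun do rewrite mxE.
apply: (interpolation_sum _ (@polycurve_class R C)) => k.
by have [_ _ EM _] := @polycurve_class R C; apply: EM.
Qed.

Lemma upow_nat n (z : 'M[C]_n) (m : nat) : unipotent z -> upow z m%:R = z ^+ m.
Proof.
move=> uz; rewrite -{2}[z](subrK 1%:M); set N := z - 1%:M in uz *.
have NX k : (n <= k)%N -> N ^+ k = 0.
  by move=> nk; rewrite -(subnK nk) exprD uz; exact: mulmx0.
have cN1 : GRing.comm N 1%:M by rewrite /GRing.comm [LHS]mulmx1 [RHS]mul1mx.
rewrite addrC (exprDn_comm _ (commr_sym cN1)) /upow.
have E1 k : (1%:M : 'M[C]_n) ^+ k = 1%:M by exact: expr1n.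
under [RHS]eq_bigr do rewrite E1 [_ * _]mul1mx -scaler_nat.
pose F k := 'C(m, k)%:R *: N ^+ k.
(* The sums cut off at [n] and at [m.+1] are both extended by zeros to [n + m.+1]: the extra terms
   vanish through the nilpotent power in one case, through the binomial coefficient in the other. *)
have widen j : (forall i, (j <= i)%N -> F i = 0) -> (j <= n + m.+1)%N ->
    \sum_(i < j) F i = \sum_(i < n + m.+1) F i.
  move=> F0 jnm; rewrite (big_ord_widen _ F jnm) big_mkcond /=.
  by apply: eq_bigr => i _; case: ltnP => // /F0.
transitivity (\sum_(i < n) F i).
  by apply: eq_bigr => k _; rewrite /F rmorph_nat binc_nat.
transitivity (\sum_(i < m.+1) F i); last by [].
have F0n i : (n <= i)%N -> F i = 0 by move=> ni; rewrite /F NX // scaler0.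
have F0m i : (m < i)%N -> F i = 0 by move=> mi; rewrite /F bin_small // scale0r.
by rewrite (widen _ F0n (leq_addr _ _)) (widen _ F0m (leq_addl _ _)).
Qed.

Lemma upow0 n (z : 'M[C]_n) : unipotent z -> upow z 0 = 1%:M.
Proof. by move=> uz; rewrite (upow_nat 0 uz). Qed.

Lemma upow1mx n t : upow (1%:M : 'M[C]_n) t = 1%:M.
Proof.
have u1 : unipotent (1%:M : 'M[C]_n).
  rewrite /unipotent subrr; case: n => [|n]; first by apply/matrixP => -[].
  by rewrite expr0n.
move: t; apply: (interpolation_mx_eq (@polycurve_class R C)).
- exact: upow_polycurve1.
- by move=> i j; exact: polycurve_cst.
- by move=> k; rewrite upow_nat //; exact: expr1n.
Qed.

Lemma upowD n (z : 'M[C]_n) s t : unipotent z ->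
  upow z (s + t) = upow z s *m upow z t.
Proof.
move=> uz; have pz := @upow_polycurve1 n z.
have pzD u i j : polycurve (fun t => upow z (u + t) i j).
  rewrite /upow; under eq_fun do rewrite summxE.
  apply: (interpolation_sum _ (@polycurve_class R C)) => k.
  exists ((((z - 1%:M) ^+ k) i j)%:P * (binc k \Po ((ofR u)%:P + 'X))) => v.
  rewrite mxE hornerM hornerC horner_comp.
  have -> : ((ofR u)%:P + 'X).[ofR v] = ofR (u + v) :> C.
    by rewrite hornerD hornerC hornerX rmorphD.
  exact: mulrC.
(* Interpolation in one variable at a time: with the first exponent natural the second becomes real,
   then the first one does. *)
have natD (m : nat) u : upow z (m%:R + u) = upow z m%:R *m upow z u.
  move: u; apply: (interpolation_mx_eq (@polycurve_class R C)) => [i j|i j|k].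
  - exact: pzD.
  - by apply: polycurve_mulmx => // k l; exact: polycurve_cst.
  - by rewrite -natrD !upow_nat // exprD.
move: s; apply: (interpolation_mx_eq (@polycurve_class R C)) => [i j|i j|k].
- by under eq_fun do rewrite addrC; exact: pzD.
- by apply: polycurve_mulmx => // k l; exact: polycurve_cst.
- exact: natD.
Qed.

Lemma upow_unit n (z : 'M[C]_n) t : unipotent z -> upow z t \in unitmx.
Proof.
move=> uz; have : upow z t *m upow z (- t) = 1%:M by rewrite -upowD // subrr upow0.
by case/mulmx1_unit.
Qed.

Lemma upowN n (z : 'M[C]_n) t : unipotent z -> upow z (- t) = invmx (upow z t).
Proof.
move=> uz; rewrite -[LHS](mulKmx (upow_unit t uz)) -upowD // subrr upow0 //.
by rewrite mulmx1.
Qed.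

Lemma upowX n (z : 'M[C]_n) t k : unipotent z -> upow z t ^+ k = upow z (t *+ k).
Proof.
move=> uz; elim: k => [|k IHk]; first by rewrite upow0.
by rewrite exprS IHk mulrS upowD.
Qed.

Lemma upow_mxz n (z : 'M[C]_n) t p : unipotent z ->
  mxz (upow z t) p = upow z (p%:~R * t).
Proof.
move=> uz; case: p => k /=; first by rewrite upowX // mulr_natl.
by rewrite upowX // NegzE mulrNz mulNr upowN // mulr_natl.
Qed.

Lemma upow_comm n (A z : 'M[C]_n) t : A *m z = z *m A ->
  A *m upow z t = upow z t *m A.
Proof.
move=> Az; rewrite /upow mulmx_sumr mulmx_suml; apply: eq_bigr => k _.
rewrite -scalemxAr -scalemxAl; congr (_ *: _); apply: comm_mxX.
by rewrite mulmxBr mulmxBl Az mulmx1 mul1mx.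
Qed.

Lemma upow_in n (G : set 'M[C]_n) (y z : 'M[C]_n) t : sl_group G ->
  G y -> G z -> unipotent z -> G (y *m upow z t).
Proof.
move=> sG Gy Gz uz; move: t.
apply: (zclosed_curve (@polycurve_class R C) _ (slg_zclosed sG)) => [i j|k].
  apply: polycurve_mulmx => i' j'; first exact: polycurve_cst.
  exact: upow_polycurve1.
by rewrite upow_nat //; apply: (slgM sG) => //; exact: slgX.
Qed.

Lemma horner_continuous (p : {poly C}) : continuous (horner p).
Proof.
elim/poly_ind: p => [|p c IHp].
  rewrite (_ : horner 0 = fun=> 0); first exact: cst_continuous.
  by apply/funext => u; rewrite horner0.
rewrite (_ : horner _ = fun u => p.[u] * u + c); last first.
  by apply/funext => u; rewrite hornerD hornerM hornerX hornerC.
move=> u; apply: (@cvgD _ _ _ (nbhs u)); last exact: cvg_cst.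
by apply: (@cvgM _ _ (nbhs u)); [exact: IHp|exact: cvg_id].
Qed.

Lemma cvg_upow T (F : set_system T) {FF : Filter F} n
  (f : T -> 'M[C]_n) (g : T -> R) (z : 'M[C]_n) (t : R) :
  f @ F --> z -> g @ F --> t -> upow (f x) (g x) @[x --> F] --> upow z t.
Proof.
move=> fz gt; apply: cvg_summx => k; apply: cvg_scalemx.
  apply: (@continuous_cvg _ _ _ F _ g (fun t : R => (binc k).[ofR t] : C)) => //.
  apply: (@continuous_comp _ _ _ (@ofR R C) (fun u : C => (binc k).[u])).
    exact: ofR_continuous.
  exact: horner_continuous.
apply: cvg_expmx; apply: cvg_addmx => //; exact: cvg_cst.
Qed.

(** A unitary matrix is diagonalizable, and unipotency forces [(d - 1) ^+ n = 0] for each eigenvalue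
    [d]. *)
Lemma unitary_unipotent n (z : 'M[C]_n) :
  z \is unitarymx -> unipotent z -> z = 1%:M.
Proof.
move=> uz nz; have [zz' z'z] := unitarymxK uz.
have /orthomx_spectralP : z \is normalmx by apply/normalmxP; rewrite zz' z'z.
move: (spectralmx z) (spectral_diag z) (spectral_unit z) => U d uU zE.
have UN i : row i U *m (z - 1%:M) = (d 0 i - 1) *: row i U.
  rewrite mulmxBr mulmx1 -row_mul zE !mulmxA mulmxV // mul1mx.
  by apply/rowP => j; rewrite mul_diag_mx !mxE mulrBl mul1r.
have UNk i k : row i U *m (z - 1%:M) ^+ k = (d 0 i - 1) ^+ k *: row i U.
  elim: k => [|k IHk]; first by rewrite !expr0 mulmx1 scale1r.
  by rewrite exprSr mulmxA IHk -scalemxAl UN scalerA exprSr.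
have d1 i : d 0 i = 1.
  have := UNk i n; rewrite nz mulmx0 => /esym/eqP; rewrite scaler_eq0.
  case/orP => [|/eqP U0].
    by rewrite expf_eq0 subr_eq0 => /andP[_ /eqP].
  have : row i U *m invmx U = 0 by rewrite U0 mul0mx.
  rewrite -row_mul mulmxV // => /rowP/(_ i)/eqP.
  by rewrite !mxE eqxx oner_eq0.
have -> : z = invmx U *m diag_mx d *m U by [].
have -> : d = const_mx 1 by apply/rowP => i; rewrite d1 mxE.
by rewrite diag_const_mx mulmx1 mulVmx.
Qed.

End UnipotentPowers.

(** * The Baumslag-Solitar relation for matrices *)

Section BaumslagSolitarRelation.
Variables (R : realType) (C : complexOver R) (n : nat) (p q : int).
Implicit Types x y s g : 'M[C]_n.

Definition bs_rel x y : Prop := x *m mxz y p = mxz y q *m x.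

Definition bs_exponent : nat := bs_period n (`|p| ^ 2) (`|q| ^ 2).
Local Notation M := bs_exponent.

Hypothesis pq_coprime : coprimez p q.
Hypothesis pq_abs : `|p|%N <> `|q|%N.

Lemma bs_exponent_gt0 : (0 < M)%N.
Proof. by apply: bs_period_gt0 => /eqP; rewrite eqn_exp2r // => /eqP. Qed.

Lemma coprime_bs_exponent : coprime `|p| M.
Proof.
have : coprime (`|p| ^ 2) M.
  by apply: bs_period_coprime; rewrite coprimeXl // coprimeXr.
by rewrite coprime_pexpl.
Qed.

(* Squaring [x] makes both exponents nonnegative. *)
Lemma bs_rel_sq x y : y \in unitmx -> bs_rel x y ->
  (x *m x) *m y ^+ (`|p| ^ 2) = y ^+ (`|q| ^ 2) *m (x *m x).
Proof.
move=> uy xy; have up := mxz_unit p uy; have uq := mxz_unit q uy.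
rewrite -!mxz_sq // -mulmxA (intertwine_mxz p up uq xy) (mxzC q p uy) !mulmxA.
by rewrite (intertwine_mxz q up uq xy).
Qed.

Lemma bs_rel_unipotent x y : x \in unitmx -> y \in unitmx -> bs_rel x y ->
  unipotent (y ^+ M).
Proof.
move=> ux uy /(bs_rel_sq uy); apply: bs_unipotent => //.
by rewrite unitmx_mul ux.
Qed.

Lemma mulmxX_comm y j : y *m y ^+ j = y ^+ j *m y.
Proof. exact: comm_mxX. Qed.

Lemma bs_rel_upow x y t : x \in unitmx -> y \in unitmx -> bs_rel x y ->
  bs_rel x (y *m upow (y ^+ M) t).
Proof.
move=> ux uy xy; have uz := bs_rel_unipotent ux uy xy.
set z := y ^+ M in uz *.
(* At [t = k] this is the [M k]-th power of the relation; both sides are polynomial in [t], so it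
   holds for all real [t]. *)
have xz : x *m upow z (p%:~R * t) = upow z (q%:~R * t) *m x.
  move: t; apply: (interpolation_mx_eq (@polycurve_class R C)).
  - apply: polycurve_mulmx => i j; first exact: polycurve_cst.
    exact: upow_polycurve.
  - apply: polycurve_mulmx => i j; first exact: upow_polycurve.
    exact: polycurve_cst.
  move=> k; rewrite -!upow_mxz // !upow_nat // /z -expmxM !mxzX //.
  exact: intertwineX.
have yz : y *m upow z t = upow z t *m y by apply: upow_comm; exact: mulmxX_comm.
rewrite /bs_rel !(mxzM _ uy (upow_unit t uz) yz) !upow_mxz // !mulmxA xy.
by rewrite -(mulmxA _ x) xz mulmxA.
Qed.

Lemma bs_upow_order x y : x \in unitmx -> y \in unitmx -> bs_rel x y ->
  (y *m upow (y ^+ M) (- M%:R^-1)) ^+ M = 1%:M.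
Proof.
move=> ux uy xy; have uz := bs_rel_unipotent ux uy xy.
set z := y ^+ M in uz *.
have yz t : y *m upow z t = upow z t *m y by apply: upow_comm; exact: mulmxX_comm.
rewrite [LHS](exprMn_comm M (yz (- M%:R^-1))) upowX // -/z.
have M0 : M%:R != 0 :> R by rewrite pnatr_eq0 -lt0n bs_exponent_gt0.
rewrite mulNrn -(mulr_natr M%:R^-1) mulVf //.
have := upowD 1 (-1) uz; rewrite subrr (upow0 uz) (upow_nat 1 uz) expr1.
exact: esym.
Qed.

Lemma bs_rel_conj g x y : g \in unitmx -> y \in unitmx -> bs_rel x y ->
  bs_rel (g *m x *m invmx g) (g *m y *m invmx g).
Proof.
move=> ug uy xy.
have uY : g *m y *m invmx g \in unitmx by rewrite !unitmx_mul ug uy unitmx_inv.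
have E z : mxz (g *m y *m invmx g) z = g *m mxz y z *m invmx g.
  have gy : g *m y = g *m y *m invmx g *m g by rewrite mulmxKV.
  by rewrite (intertwine_mxz z uy uY gy) mulmxK.
have K A B : g *m A *m invmx g *m (g *m B *m invmx g) = g *m (A *m B) *m invmx g.
  by rewrite !mulmxA mulmxKV.
by rewrite /bs_rel !E !K xy.
Qed.

(** For unitary [s] the adjoint of the relation reads [x^* s^q = s^p x^*], so [x^* x] commutes with
    [s^p]. As [p] is prime to [M], Bezout makes [s] a power of [s^|p|]. *)
Lemma bs_rel_gram_comm x s : s \is unitarymx -> s ^+ M = 1%:M -> bs_rel x s ->
  (x ^t* *m x) *m s = s *m (x ^t* *m x).
Proof.
move=> us sM xs; have uus := unitarymx_unit us.
have sV z : (mxz s z) ^t* = invmx (mxz s z).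
  have usz : mxz s z \is unitarymx.
    have usX j : s ^+ j \is unitarymx.
      elim: j => [|j IHj]; first by apply/unitarymxP; rewrite trmxC1 mulmx1.
      by rewrite exprS; exact: mul_unitarymx.
    by case: z => j //=; rewrite invmx_unitary // trmxC_unitary.
  by rewrite invmx_unitary.
have up := mxz_unit p uus; have uq := mxz_unit q uus.
have xsA : x ^t* *m mxz s q = mxz s p *m x ^t*.
  have := congr1 (fun A : 'M[C]_n => mxz s p *m A ^t* *m mxz s q) xs.
  by rewrite /= !trmxC_mul !sV !mulmxA mulmxV // mul1mx mulmxKV.
have Bp : (x ^t* *m x) *m mxz s p = mxz s p *m (x ^t* *m x).
  by rewrite -mulmxA xs !mulmxA xsA.
have [k kp] : exists k, s ^+ (`|p| * k) = s.
  (* For [M = 1] the matrix [s] is the identity, and [p] may be 0. For [M > 1] coprimality excludes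
     [p = 0], which the Bezout identity below requires. *)
  have [|M1] := leqP M 1.
    rewrite leq_eqVlt ltnNge bs_exponent_gt0 orbF => /eqP M1.
    by exists 0%N; move: sM; rewrite M1 expr1 muln0 => ->; exact: expr0.
  have [[k l] /= kl] : exists kl : nat * nat, (`|p| * kl.1 = kl.2 * M + 1)%N.
    have p0 : (0 < `|p|)%N.
      rewrite lt0n; apply: contraTneq coprime_bs_exponent => ->.
      by rewrite /coprime gcd0n neq_ltn M1 orbT.
    have [k l kl _] := egcdnP M p0.
    by exists (k, l); rewrite mulnC kl (eqP coprime_bs_exponent).
  exists k; rewrite kl exprD mulnC expmxM sM expr1.
  by rewrite (_ : 1%:M ^+ l = 1%:M); [exact: mul1mx|exact: expr1n].
rewrite -{1 2}kp expmxM; apply: comm_mxX.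
case: (p) Bp => j /= Bp; first exact: Bp.
have ujs := unitmxX j.+1 uus.
have := intertwine_inv _ _ Bp; rewrite !unitmx_inv invmxK; exact.
Qed.

End BaumslagSolitarRelation.

(** * Concatenation and transport of strong deformation retractions *)

Section WithinContinuity.

Lemma cvg_pair2 T (U V : topologicalType) (F : set_system T) {FF : Filter F}
    (f : T -> U) (g : T -> V) (a : U) (b : V) :
  f @ F --> a -> g @ F --> b -> (f x, g x) @[x --> F] --> (a, b).
Proof. by move=> fa gb; exact: (cvg_pair fa gb). Qed.

Lemma within_continuous_comp (S T U : topologicalType) (P : set S) (A : set T)
    (g : S -> T) (f : T -> U) :
  {within P, continuous g} -> (forall x, P x -> A (g x)) ->
  {within A, continuous f} -> {within P, continuous (f \o g)}.
Proof.
move=> /subspace_continuousP cg PA /subspace_continuousP cf.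
apply/subspace_continuousP => x Px W fW.
have H : nbhs x (fun s => P s -> A (g s) -> W (f (g s))) :=
  cg x Px _ (cf (g x) (PA x Px) W fW).
suff : nbhs x (fun s => P s -> W (f (g s))) by [].
by apply: filterS H => s H Ps; exact: H Ps (PA s Ps).
Qed.

Lemma within_continuous_eq (S T : topologicalType) (P : set S) (f g : S -> T) :
  (forall x, P x -> f x = g x) ->
  {within P, continuous f} -> {within P, continuous g}.
Proof.
move=> fg /subspace_continuousP cf; apply/subspace_continuousP => x Px.
suff : g @ within P (nbhs x) --> g x by [].
rewrite -(fg x Px); apply: cvg_trans (cf x Px); apply: near_eq_cvg.
by rewrite near_withinE; apply: filterE => y /fg.
Qed.

Lemma within_continuousW (S T : topologicalType) (P : set S) (f : S -> T) x :
  continuous f -> f @ within P (nbhs x) --> f x.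
Proof. by move=> cf; apply: cvg_within_filter; exact: cf. Qed.

Variable R : realType.

(** The homotopies are run one after the other at double speed. Since [X] is closed, the two halves
    of the cylinder are closed and continuity can be glued. *)
Lemma sdr_trans (T : topologicalType) (X A B : set T) (H1 H2 : R * T -> T) :
  closed X -> strong_deformation_retraction X A H1 ->
  strong_deformation_retraction A B H2 ->
  exists H : R * T -> T, strong_deformation_retraction X B H.
Proof.
move=> clX [AX [c1 [H1X H10 H11 H1A]]] [BA [c2 [H2A H20 H21 H2B]]].
pose H (w : R * T) := if w.1 <= 2^-1 then H1 (2 * w.1, w.2)
  else H2 (2 * w.1 - 1, H1 (1, w.2)).
have two : 2 * 2^-1 = 1 :> R by rewrite mulfV.
have I1 : `[0, 1]%classic (1 : R) by rewrite /= in_itv /= ler01 lexx.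
have Ilo (t : R) : 0 <= t -> t <= 2^-1 -> `[0, 1]%classic (2 * t).
  by move=> t0 t1; rewrite /= in_itv /=; apply/andP; split; lra.
have Ihi (t : R) : 2^-1 <= t -> t <= 1 -> `[0, 1]%classic (2 * t - 1).
  by move=> t0 t1; rewrite /= in_itv /=; apply/andP; split; lra.
have in01 (t : R) : `[0, 1]%classic t -> 0 <= t /\ t <= 1.
  by rewrite /= in_itv /= => /andP[].
exists H; split; first by move=> x /BA /AX.
split; last first.
  split.
  - move=> t x /in01[t0 t1] Xx; rewrite /H /=; case: ltP => [/ltW|] t2.
      by apply/AX/H2A; [exact: Ihi|exact: H11].
    by apply: H1X => //; exact: Ilo.
  - by move=> x Xx; rewrite /H /= invr_ge0 ler0n mulr0 H10.
  - move=> x Xx; rewrite /H /= ifF; last by apply/negbTE; rewrite -ltNge; lra.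
    by rewrite (_ : 2 * 1 - 1 = 1); [exact/H21/H11|lra].
  - move=> t x /in01[t0 t1] Bx; rewrite /H /=; case: ltP => [/ltW|] t2.
      by rewrite H1A //; [apply: H2B => //; exact: Ihi|exact: BA].
    by rewrite H1A //; [exact: Ilo|exact: BA].
pose P1 : set (R * T) := `[0, 2^-1]%classic `*` X.
pose P2 : set (R * T) := `[2^-1, 1]%classic `*` X.
have -> : `[0, 1]%classic `*` X = P1 `|` P2.
  apply/seteqP; split=> [[t x] [/in01[/= t0 t1] Xx]|[t x]].
    case: (leP t 2^-1) => [t2|/ltW t2]; [left|right];
      by split=> //=; rewrite in_itv /= ?t0 ?t1 t2.
  by move=> [[/= + Xx]|[/= + Xx]]; rewrite in_itv /= => /andP[t0 t1];
    split=> //=; rewrite in_itv /=; apply/andP; split; lra.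
have clP (a b : R) : closed (`[a, b]%classic `*` X).
  have -> : `[a, b]%classic `*` X = (fst @^-1` `[a, b]%classic) `&` (snd @^-1` X) :> set (R * T).
    by apply/seteqP; split.
  apply: closedI; apply: closed_comp => //.
  - by move=> w _; exact: cvg_fst.
  - exact: itv_closed.
  - by move=> w _; exact: cvg_snd.
have clin (a b : R) : continuous (fun t : R => a * t + b).
  move=> t; apply: (@cvgD _ _ _ (nbhs t)); last exact: cvg_cst.
  by apply: (@cvgM _ _ (nbhs t)); [exact: cvg_cst|exact: cvg_id].
have cg a b (h : T -> T) P : (forall w, P w -> X w.2) -> {within X, continuous h} ->
    {within P, continuous (fun w : R * T => (a * w.1 + b, h w.2))}.
  move=> PX ch; apply/subspace_continuousP => w Pw.
  apply: (@cvg_pair2 _ _ _ (within P (nbhs w))).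
    apply: (@within_continuousW _ _ _ (fun w : R * T => a * w.1 + b)) => v.
    apply: (@continuous_comp _ _ _ fst (fun t => a * t + b)); first exact: cvg_fst.
    exact: clin.
  have : {within P, continuous (h \o snd)}.
    apply: (within_continuous_comp _ PX ch).
    by apply: continuous_subspaceT => v; exact: cvg_snd.
  by move=> /subspace_continuousP; exact.
have cH1 : {within X, continuous (fun x => H1 (1, x))}.
  have := @within_continuous_comp _ _ _ X _ (fun x : T => (1 : R, x)) H1 _ _ c1.
  apply => //.
  by apply: continuous_subspaceT => x; apply: (@cvg_pair2 _ _ _ (nbhs x)); [exact: cvg_cst|exact: cvg_id].
have := @withinU_continuous _ _ P1 P2 H (clP _ _) (clP _ _); apply.
  have K1 : {within P1, continuous (H1 \o (fun w : R * T => (2 * w.1 + 0, id w.2)))}.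
    have := @within_continuous_comp _ _ _ P1 _
      (fun w : R * T => (2 * w.1 + 0, id w.2)) H1 _ _ c1; apply.
      apply: (cg 2 0 id) => [w []//|]; apply: continuous_subspaceT => x; exact: cvg_id.
    move=> [t x] [/= + Xx]; rewrite in_itv /= => /andP[t0 t1]; split=> //=.
    by rewrite addr0; exact: Ilo.
  apply: (within_continuous_eq _ K1).
  move=> [t x] [/= + Xx]; rewrite in_itv /= => /andP[t0 t1].
  by rewrite /H /= t1 addr0.
have K2 : {within P2, continuous (H2 \o (fun w : R * T => (2 * w.1 + -1, H1 (1, w.2))))}.
  have := @within_continuous_comp _ _ _ P2 _
    (fun w : R * T => (2 * w.1 + -1, H1 (1, w.2))) H2 _ _ c2; apply.
    by apply: (cg 2 (-1) (fun x => H1 (1, x))) => // w [].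
  move=> [t x] [/= + Xx]; rewrite in_itv /= => /andP[t0 t1]; split=> /=.
    exact: Ihi.
  exact: H11.
apply: (within_continuous_eq _ K2).
move=> [t x] [/= + Xx]; rewrite in_itv /= => /andP[t0 t1].
(* At [t = 2^-1] the definition of [H] takes its first branch; the second one agrees because [H2]
   starts at the identity. *)
rewrite /H /=; case: leP => // t2.
have -> : t = 2^-1 by apply/eqP; rewrite eq_le t2.
by rewrite two subrr H20 //; exact: H11.
Qed.

Lemma sdr_homotopy_equivalent (T : topologicalType) (X A : set T) (H : R * T -> T) :
  strong_deformation_retraction X A H -> homotopy_equivalent R X A.
Proof.
move=> [AX [cH [HX H0 H1 HA]]].
have I1 : `[0, 1]%classic (1 : R) by rewrite /= in_itv /= ler01 lexx.
have I0 : `[0, 1]%classic (0 : R) by rewrite /= in_itv /= ler01 lexx.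
have I1B (t : R) : `[0, 1]%classic t -> `[0, 1]%classic (1 - t).
  by rewrite /= !in_itv /= => /andP[t0 t1]; apply/andP; split; lra.
exists (fun x => H (1, x)), id; split.
- split=> //; have := @within_continuous_comp _ _ _ X _ (fun x : T => (1 : R, x)) H _ _ cH.
  apply=> //.
  by apply: continuous_subspaceT => x; apply: (@cvg_pair2 _ _ _ (nbhs x)); [exact: cvg_cst|exact: cvg_id].
- by split=> //; apply: continuous_subspaceT => x; exact: cvg_id.
(* Time is reversed, as the homotopy has to run from the retraction to the identity. *)
- exists (fun w => H (1 - w.1, w.2)); split=> //=.
  + have := @within_continuous_comp (R * _)%type _ _ (`[0, 1]%classic `*` X) _ (fun w : R * T => (1 - w.1, w.2)) H _ _ cH.
    apply.
      apply: continuous_subspaceT => w; apply: (@cvg_pair2 _ _ _ (nbhs w)); last exact: cvg_snd.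
      by apply: (@cvgB _ _ _ (nbhs w)); [exact: cvg_cst|exact: cvg_fst].
    by move=> [t x] [/= /I1B It Xx].
  + by move=> t x /I1B; exact: HX.
  + by move=> x Xx; rewrite subr0.
  + by move=> x Xx; rewrite subrr H0.
- exists snd; split=> //=.
  + by apply: continuous_subspaceT => w; exact: cvg_snd.
  + by move=> x Ax; rewrite HA.
Qed.

Lemma sdr_homeo (S T : topologicalType) (f : S -> T) (g : T -> S)
    (X A : set S) (X' A' : set T) (H : R * S -> S) :
  continuous f -> continuous g -> cancel f g -> cancel g f ->
  (forall y, X' y <-> X (g y)) -> (forall y, A' y <-> A (g y)) ->
  strong_deformation_retraction X A H ->
  strong_deformation_retraction X' A' (fun w => f (H (w.1, g w.2))).
Proof.
move=> cf cg fK gK XE AE [AX [cH [HX H0 H1 HA]]]; split.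
  by move=> y /AE /AX /XE.
split; last first.
  split=> [t y It|y|y|t y It].
  - by move=> /XE Xy; apply/XE; rewrite fK; exact: HX.
  - by move=> /XE Xy; rewrite /= H0.
  - by move=> /XE Xy; apply/AE; rewrite fK; exact: H1.
  - by move=> /AE Ay; rewrite /= HA.
apply: (@within_continuous_comp _ _ _ _ setT (fun w => H (w.1, g w.2)) f) => //.
  have := @within_continuous_comp (R * _)%type _ _ (`[0, 1]%classic `*` X') _ (fun w : R * T => (w.1, g w.2)) H _ _ cH.
  apply.
    apply: continuous_subspaceT => w; apply: (@cvg_pair2 _ _ _ (nbhs w)); first exact: cvg_fst.
    by apply: (@continuous_comp _ _ _ snd g); [exact: cvg_snd|exact: cg].
  by move=> [t y] [/= It /XE].
exact: continuous_subspaceT.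
Qed.

End WithinContinuity.

(** * The three deformations for a selfadjoint group *)

Section Retractions.
Variables (R : realType) (C : complexOver R) (n : nat) (p q : int).
Hypothesis pq_coprime : coprimez p q.
Hypothesis pq_abs : `|p|%N <> `|q|%N.
Local Notation MM := ('M[C]_n * 'M[C]_n)%type.
Local Notation M := (bs_exponent n p q).

Definition bs_set (G : set 'M[C]_n) : set MM :=
  [set xy | [/\ G xy.1, G xy.2 & bs_rel p q xy.1 xy.2]].

Definition unitary_in (G : set 'M[C]_n) : set 'M[C]_n :=
  [set A | G A /\ A \is unitarymx].

(* On matrices of determinant 1 this is [mxz], but it is continuous everywhere. *)
Definition adjz (A : 'M[C]_n) (z : int) : 'M[C]_n :=
  match z with Posz k => A ^+ k | Negz k => \adj (A ^+ k.+1) end.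

Lemma adjzE A z : \det A = 1 -> adjz A z = mxz A z.
Proof.
move=> dA; case: z => // k; rewrite /adjz /mxz /invmx unitmxX; last first.
  by rewrite unitmxE dA unitr1.
have -> : \det (A ^+ k.+1) = 1.
  elim: k.+1 => [|j IHj]; first exact: det1.
  by rewrite exprS [LHS]det_mulmx dA IHj mulr1.
by rewrite invr1 scale1r.
Qed.

Lemma adjz_continuous z : continuous (fun A => adjz A z).
Proof.
move=> A; case: z => k /=; last apply: (@cvg_adjugate _ _ (nbhs A)).
  by apply: (@cvg_expmx _ _ (nbhs A)); exact: cvg_id.
by apply: (@cvg_expmx _ _ (nbhs A)); exact: cvg_id.
Qed.

(** This supplies the closedness needed for gluing in [sdr_trans]. With adjugates in place of
    inverses the relation equates continuous functions. *)
Lemma closed_bs_set G : sl_group G -> closed (bs_set G).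
Proof.
move=> sG; have clG := zclosed_closed (slg_zclosed sG).
have -> : bs_set G = (fst @^-1` G) `&` ((snd @^-1` G) `&`
    [set w : MM | w.1 *m adjz w.2 p = adjz w.2 q *m w.1]).
  apply/seteqP; split=> -[x y] /=.
    by move=> [Gx Gy xy]; do !split=> //; rewrite !adjzE ?(slg_det sG).
  by move=> [Gx [Gy xy]]; split=> //; rewrite /bs_rel -!adjzE ?(slg_det sG).
have cadj z : continuous (fun w : MM => adjz w.2 z).
  move=> w; apply: (@continuous_comp _ _ _ snd (fun A => adjz A z)).
    exact: cvg_snd.
  exact: adjz_continuous.
apply: closedI; first by apply: closed_comp => // w _; exact: cvg_fst.
apply: closedI; first by apply: closed_comp => // w _; exact: cvg_snd.
apply: closed_eqmx => w.
  exact: (@cvg_mulmx _ _ (nbhs w) _ _ _ _ _ _ _ _ cvg_fst (cadj p w)).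
exact: (@cvg_mulmx _ _ (nbhs w) _ _ _ _ _ _ _ _ (cadj q w) cvg_fst).
Qed.

Definition bs_finite (G : set 'M[C]_n) : set MM :=
  bs_set G `&` [set w | w.2 ^+ M = 1%:M].

Definition bs_unitary (G : set 'M[C]_n) : set MM :=
  bs_finite G `&` [set w | w.2 \is unitarymx].

(** The homotopy is polynomial in its data, hence continuous on the whole space; on [bs_finite] the
    power [y ^+ M] is 1 and the path is constant. *)
Lemma unipotent_retraction G : sl_group G ->
  strong_deformation_retraction (bs_set G) (bs_finite G)
    (fun w : R * MM => (w.2.1, w.2.2 *m upow (w.2.2 ^+ M) (w.1 * - M%:R^-1))).
Proof.
move=> sG; split; first by move=> w [].
split.
  apply: continuous_subspaceT => w.
  have c2 : v.2.2 @[v --> nbhs w] --> w.2.2.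
    by apply: (@cvg_comp _ _ _ snd snd _ (nbhs w.2)); [exact: cvg_snd|exact: cvg_snd].
  apply: (@cvg_pair2 _ _ _ (nbhs w)).
    by apply: (@cvg_comp _ _ _ snd fst _ (nbhs w.2)); [exact: cvg_snd|exact: cvg_fst].
  apply: (@cvg_mulmx _ _ (nbhs w)); first exact: c2.
  apply: (@cvg_upow _ _ _ (nbhs w)); first exact: cvg_expmx.
  by apply: (@cvgM _ _ (nbhs w)); [exact: cvg_fst|exact: cvg_cst].
have H x y t : bs_set G (x, y) -> bs_set G (x, y *m upow (y ^+ M) t).
  move=> [/= Gx Gy xy].
  have ux := slg_unit sG Gx; have uy := slg_unit sG Gy.
  split=> //=; last exact: bs_rel_upow.
  apply: (upow_in _ sG Gy (slgX M sG Gy)); exact: bs_rel_unipotent ux uy xy.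
split=> [t [x y] _ xy|[x y] [/= Gx Gy xy]|[x y] xy|t [x y] _ [_ /= yM]].
- exact: H.
- have ux := slg_unit sG Gx; have uy := slg_unit sG Gy.
  by rewrite mul0r (upow0 (bs_rel_unipotent ux uy xy)) mulmx1.
- split; first exact: H.
  move: xy => [/= Gx Gy xy]; rewrite mul1r.
  exact: (bs_upow_order pq_abs (slg_unit sG Gx) (slg_unit sG Gy) xy).
- by rewrite yM upow1mx mulmx1.
Qed.

Definition center_root (G : set 'M[C]_n) (s : 'M[C]_n) (t : R) : 'M[C]_n :=
  mxpow (cyc_center M G s) t.

(** The inverse of the conjugating matrix is written as a power with negative exponent, so that
    continuity of [mxpow] covers both factors. At the end, with [g^2 = Q], the equation
    [s^* Q s = Q] says exactly that [g s g^-1] is unitary. *)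
Lemma unitary_retraction G : selfadjoint_group G ->
  strong_deformation_retraction (bs_finite G) (bs_unitary G)
    (fun w : R * MM =>
       (center_root G w.2.2 (w.1 * 2^-1) *m w.2.1 *m center_root G w.2.2 (w.1 * - 2^-1),
        center_root G w.2.2 (w.1 * 2^-1) *m w.2.2 *m center_root G w.2.2 (w.1 * - 2^-1))).
Proof.
move=> saG; have sG : sl_group G := saG; have M0 := bs_exponent_gt0 n pq_abs.
have mQ s : G s -> posdef_in G (cyc_center M G s).
  by move=> Gs; case: (cyc_centerP sG Gs M0).
have rV s t : G s -> center_root G s (t * - 2^-1) = invmx (center_root G s (t * 2^-1)).
  by move=> /mQ[_ pQ]; rewrite /center_root mulrN (mxpowN _ pQ).
split; first by move=> w [].
split.
  apply/subspace_continuousP => w Pw; set F := within _ _.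
  have FF : Filter F by exact: within_filter.
  have cr c : center_root G v.2.2 (v.1 * c) @[v --> F] --> center_root G w.2.2 (w.1 * c).
    have := @within_continuous_comp (R * MM)%type _ _ (`[0, 1]%classic `*` bs_finite G) _
      (fun v : R * MM => (v.1 * c, cyc_center M G v.2.2)) (fun z => mxpow z.2 z.1) _ _
      (@mxpow_continuous R C n).
    move=> /(_ _ _)/subspace_continuousP; apply => //.
      apply/subspace_continuousP => u Pu; set E := within _ _.
      have EF : Filter E by exact: within_filter.
      apply: (@cvg_pair2 _ _ _ E).
        apply: cvgM; last exact: cvg_cst.
        by apply: cvg_within_filter; exact: cvg_fst.
      have := @within_continuous_comp (R * MM)%type _ _ (`[0, 1]%classic `*` bs_finite G) _
        (fun v : R * MM => v.2.2) (cyc_center M G) _ _ (cyc_center_continuous sG M0).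
      move=> /(_ _ _)/subspace_continuousP; apply => //.
        apply: continuous_subspaceT => v.
        by apply: (@cvg_comp _ _ _ snd snd _ (nbhs v.2)); [exact: cvg_snd|exact: cvg_snd].
      by move=> v [_ [[]]].
    by move=> v [_ [[_ /mQ[]]]].
  have c1 : v.2.1 @[v --> F] --> w.2.1.
    apply: cvg_within_filter.
    by apply: (@cvg_comp _ _ _ snd fst _ (nbhs w.2)); [exact: cvg_snd|exact: cvg_fst].
  have c2 : v.2.2 @[v --> F] --> w.2.2.
    apply: cvg_within_filter.
    by apply: (@cvg_comp _ _ _ snd snd _ (nbhs w.2)); [exact: cvg_snd|exact: cvg_snd].
  exact: (cvg_pair2 (cvg_mulmx (cvg_mulmx (cr _) c1) (cr _))
    (cvg_mulmx (cvg_mulmx (cr _) c2) (cr _))).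
have Gr s t : G s -> G (center_root G s t).
  by move=> /mQ[GQ pQ]; exact: slg_mxpow.
have H t x y : bs_finite G (x, y) -> bs_finite G
   (center_root G y (t * 2^-1) *m x *m center_root G y (t * - 2^-1),
    center_root G y (t * 2^-1) *m y *m center_root G y (t * - 2^-1)).
  move=> [[/= Gx Gy xy] yM].
  have Gg := Gr y (t * 2^-1) Gy; have ug := slg_unit sG Gg.
  have GM := slgM sG; have GV := slgV sG; have uy := slg_unit sG Gy.
  rewrite (rV y t Gy); set g := center_root _ _ _ in Gg ug *.
  split; first split=> /=.
  - by apply: (GM) => //; [exact: GM|exact: GV].
  - by apply: (GM) => //; [exact: GM|exact: GV].
  - exact: bs_rel_conj.
  have gy : g *m y = g *m y *m invmx g *m g by rewrite mulmxKV.
  have := intertwineX M gy; rewrite yM mulmx1 /=.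
  by move=> /(congr1 (fun A => A *m invmx g)); rewrite mulmxV // mulmxK.
split=> [t [x y] _ xy|[x y] [[/= Gx Gy xy] yM]|[x y] xy|t [x y] _ [[[/= Gx Gy xy] yM] uy]].
- exact: H.
- have [_ pQ] := mQ y Gy.
  by rewrite /center_root !mul0r (mxpow0 pQ) !mul1mx !mulmx1.
- split; first exact: H.
  move: xy => [[/= Gx Gy xy] yM] /=.
  have [_ pQ] := mQ y Gy; have fQ := cyc_center_fixed saG Gy M0 yM.
  rewrite (rV y 1 Gy) mul1r /center_root.
  have gg := mxpow_half pQ; have pg := mxpow_posdef 2^-1 pQ.
  set g := mxpow _ _ in gg pg *; have gh := posdef_herm pg.
  have ug := posdef_unit pg; clearbody g.
  rewrite -trmxC_unitary; apply/unitarymxP.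
  rewrite trmxCK !trmxC_mul trmxC_inv gh.
  have -> : invmx g *m (y ^t* *m g) *m (g *m y *m invmx g) =
      invmx g *m (y ^t* *m (g *m g) *m y) *m invmx g by rewrite !mulmxA.
  by rewrite gg fQ -gg (mulKmx ug) mulmxV.
- rewrite /center_root (cyc_center_unitary sG Gy M0 uy) !mxpow1mx.
  by rewrite !mul1mx !mulmx1.
Qed.

Lemma polar_retraction G : selfadjoint_group G ->
  strong_deformation_retraction (bs_unitary G) (bs_set (unitary_in G))
    (fun w : R * MM =>
       (w.2.1 *m mxpow (w.2.1 ^t* *m w.2.1) (w.1 * - 2^-1), w.2.2)).
Proof.
move=> saG; have sG : sl_group G := saG.
have pX x : G x -> posdef_in G (x ^t* *m x).
  move=> Gx; split; last exact: posdef_gram (slg_unit sG Gx).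
  by apply: (slgM sG) => //; exact: sag_adj.
split.
  move=> [x s] [/= [Gx ux] [Gs us] xs]; split=> //; split=> //=.
  (* A unitary pair satisfying the relation already has [s ^+ M = 1], since this power is both
     unitary and unipotent. *)
  apply: unitary_unipotent.
    by elim: M => [|j IHj]; [apply/unitarymxP; rewrite trmxC1 mulmx1|
      rewrite exprS; exact: mul_unitarymx].
  exact: (bs_rel_unipotent (unitarymx_unit ux) (unitarymx_unit us) xs).
split.
  apply/subspace_continuousP => w Pw; set F := within _ _.
  have FF : Filter F by exact: within_filter.
  have c1 : v.2.1 @[v --> F] --> w.2.1.
    apply: cvg_within_filter.
    by apply: (@cvg_comp _ _ _ snd fst _ (nbhs w.2)); [exact: cvg_snd|exact: cvg_fst].
  have c2 : v.2.2 @[v --> F] --> w.2.2.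
    apply: cvg_within_filter.
    by apply: (@cvg_comp _ _ _ snd snd _ (nbhs w.2)); [exact: cvg_snd|exact: cvg_snd].
  have cp : mxpow (v.2.1 ^t* *m v.2.1) (v.1 * - 2^-1) @[v --> F] -->
      mxpow (w.2.1 ^t* *m w.2.1) (w.1 * - 2^-1).
    have := @within_continuous_comp (R * MM)%type _ _ (`[0, 1]%classic `*` bs_unitary G) _
      (fun v : R * MM => (v.1 * - 2^-1, v.2.1 ^t* *m v.2.1)) (fun z => mxpow z.2 z.1) _ _
      (@mxpow_continuous R C n).
    move=> /(_ _ _)/subspace_continuousP; apply => //.
      apply: continuous_subspaceT => v.
      have d1 : u.2.1 @[u --> nbhs v] --> v.2.1.
        by apply: (@cvg_comp _ _ _ snd fst _ (nbhs v.2)); [exact: cvg_snd|exact: cvg_fst].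
      apply: (@cvg_pair2 _ _ _ (nbhs v)).
        by apply: (@cvgM _ _ (nbhs v)); [exact: cvg_fst|exact: cvg_cst].
      exact: (@cvg_mulmx _ _ (nbhs v) _ _ _ _ _ _ _ _ (cvg_trmxC d1) d1).
    by move=> v [_ [[[/= /pX[_ ?] _ _] _] _]].
  exact: (cvg_pair2 (cvg_mulmx c1 cp) c2).
have H t x s : bs_unitary G (x, s) ->
    bs_unitary G (x *m mxpow (x ^t* *m x) (t * - 2^-1), s).
  move=> [[[/= Gx Gs xs] sM] us]; have [GX pP] := pX x Gx.
  split=> //; split=> //; split=> //=.
    by apply: (slgM sG) => //; exact: slg_mxpow.
  have Ps := bs_rel_gram_comm pq_coprime pq_abs us sM xs.
  have uus := unitarymx_unit us.
  have sP z : mxpow (x ^t* *m x) (t * - 2^-1) *m mxz s z =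
      mxz s z *m mxpow (x ^t* *m x) (t * - 2^-1).
    by apply/esym; apply: mxpow_intertwine => //; apply/esym; exact: intertwine_mxz.
  by rewrite /bs_rel -mulmxA sP !mulmxA xs.
split=> [t [x s] _ xs|[x s] [[[/= Gx Gs xs] sM] us]|[x s] xs|t [x s] _ [/= [Gx ux] [Gs us] xs]].
- exact: H.
- by rewrite mul0r (mxpow0 (pX x Gx).2) mulmx1.
- have [[[/= Gx' Gs _] _] us] := H 1 x s xs.
  move: xs => [[[/= Gx _ xs] sM] _]; split=> //=; last first.
    by have [[[]]] := H 1 x s (conj (conj (And3 Gx Gs xs) sM) us).
  split; first exact: Gx'.
  rewrite mul1r in Gx' *; have pP := (pX x Gx).2; set P := x ^t* *m x in Gx' pP *.
  have pr := mxpow_posdef (- 2^-1) pP; have rh := posdef_herm pr.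
  rewrite -trmxC_unitary; apply/unitarymxP; rewrite trmxCK trmxC_mul rh.
  have -> : mxpow P (- 2^-1) *m x ^t* *m (x *m mxpow P (- 2^-1)) =
      mxpow P (- 2^-1) *m P *m mxpow P (- 2^-1) by rewrite /P !mulmxA.
  rewrite -[X in _ *m X *m _](mxpow1 pP) -!(mxpowD _ _ pP).
  by rewrite (_ : - 2^-1 + 1 - 2^-1 = 0); [exact: mxpow0|rewrite addrAC -opprD half_add addNr].
- by rewrite (unitarymxK ux).2 mxpow1mx mulmx1.
Qed.

Theorem bs_retraction G : selfadjoint_group G ->
  exists H : R * MM -> MM,
    strong_deformation_retraction (bs_set G) (bs_set (unitary_in G)) H.
Proof.
move=> saG; have clX := closed_bs_set saG.
have [H12 sdr12] := sdr_trans clX (unipotent_retraction saG) (unitary_retraction saG).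
exact: sdr_trans clX sdr12 (polar_retraction saG).
Qed.

End Retractions.

(** * Conjugation into unitary form and maximal compact subgroups *)

Section Conjugation.
Variables (R : realType) (C : complexOver R) (n : nat).
Implicit Types (G K D : set 'M[C]_n) (A B g h : 'M[C]_n).

(** This is [g G g^-1], written as a preimage so that membership unfolds without an existential. *)
Definition conj_set g G : set 'M[C]_n := [set A | G (invmx g *m A *m g)].

Definition compact_subgroup K : Prop :=
  [/\ compact K, K 1%:M, (forall A B, K A -> K B -> K (A *m B)) &
      forall A, K A -> K (invmx A)].

Lemma conj_mul g A B : g \in unitmx ->
  invmx g *m (A *m B) *m g = (invmx g *m A *m g) *m (invmx g *m B *m g).
Proof. by move=> ug; rewrite !mulmxA mulmxK. Qed.

Lemma conjK g A : g \in unitmx -> invmx g *m (g *m A *m invmx g) *m g = A.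
Proof. by move=> ug; rewrite !mulmxA mulVmx // mul1mx mulmxKV. Qed.

Lemma conjKV g A : g \in unitmx -> g *m (invmx g *m A *m g) *m invmx g = A.
Proof. by move=> ug; rewrite !mulmxA mulmxV // mul1mx mulmxK. Qed.

Lemma conj_inv g A : g \in unitmx -> A \in unitmx ->
  invmx g *m invmx A *m g = invmx (invmx g *m A *m g).
Proof.
move=> ug uA; have uc : invmx g *m A *m g \in unitmx.
  by rewrite !unitmx_mul unitmx_inv ug uA.
by rewrite -[LHS](mulmxK uc) -conj_mul // mulVmx // mulmx1 mulVmx // mul1mx.
Qed.

Lemma conj_set_image g G : g \in unitmx ->
  conj_set g G = (fun A => g *m A *m invmx g) @` G.
Proof.
move=> ug; apply/seteqP; split=> [A GA|_ [A GA <-]].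
  by exists (invmx g *m A *m g) => //; rewrite conjKV.
by rewrite /conj_set /= conjK.
Qed.

Lemma conj_continuous g h : continuous (fun A : 'M[C]_n => g *m A *m h).
Proof.
move=> A; apply: (@cvg_mulmx _ _ (nbhs A)); last exact: cvg_cst.
by apply: (@cvg_mulmx _ _ (nbhs A)); [exact: cvg_cst|exact: cvg_id].
Qed.

Lemma invmxM g h : g \in unitmx -> h \in unitmx ->
  invmx (g *m h) = invmx h *m invmx g.
Proof.
move=> ug uh; have ugh : g *m h \in unitmx by rewrite unitmx_mul ug.
rewrite -[RHS](mulmxK ugh) -(mulmxA (invmx h)) (mulKmx ug) mulVmx //.
by rewrite mul1mx.
Qed.

Lemma conj_set_compact g K : g \in unitmx -> compact K -> compact (conj_set g K).
Proof.
move=> ug cK; rewrite conj_set_image //; apply: continuous_compact cK.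
by apply: continuous_subspaceT => A; exact: conj_continuous.
Qed.

Lemma conj_set_subgroup g K : g \in unitmx -> K `<=` [set A | A \in unitmx] ->
  compact_subgroup K -> compact_subgroup (conj_set g K).
Proof.
move=> ug uK [cK K1 KM KV]; split.
- exact: conj_set_compact.
- by rewrite /conj_set /= mulmx1 mulVmx.
- by move=> A B KA KB; rewrite /conj_set /= conj_mul //; exact: KM.
- move=> A KA; rewrite /conj_set /= conj_inv //; first exact: KV.
  by have /uK := KA; rewrite /= !unitmx_mul unitmx_inv ug andbT.
Qed.

Lemma conj_set_slgroup g G : g \in unitmx -> sl_group G -> sl_group (conj_set g G).
Proof.
move=> ug sG; have cdet A : \det (invmx g *m A *m g) = \det A.
  by rewrite !det_mulmx mulrAC -det_mulmx mulVmx // det1 mul1r.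
have sdet A : conj_set g G A -> \det A = 1 by move=> /(slg_det sG); rewrite cdet.
split=> //.
- by rewrite /conj_set /= mulmx1 mulVmx //; exact: slg1.
- by move=> A B GA GB; rewrite /conj_set /= conj_mul //; exact: slgM sG _ _ GA GB.
- move=> A GA; rewrite /conj_set /= conj_inv //; first exact: slgV sG _ GA.
  by rewrite unitmxE (sdet A GA) unitr1.
move=> A GA; apply: (slg_zclosed sG) => f pf f0.
apply: (GA (fun B => f (invmx g *m B *m g))); first exact: polyfun_conj.
by move=> B; exact: f0.
Qed.

Definition zdense D G : Prop := forall f, polyfun f ->
  (forall B, D B -> f B = 0) -> forall A, G A -> f A = 0.

Lemma conj_set_zdense g D G : g \in unitmx ->
  zdense D G -> zdense (conj_set g D) (conj_set g G).
Proof.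
move=> ug dD f pf f0 A GA.
have := dD (fun B => f (g *m B *m invmx g)) (polyfun_conj g (invmx g) pf) _ _ GA.
rewrite conjKV //; apply=> B DB; apply: f0; rewrite /conj_set /= conjK //.
Qed.

(* On the dense subgroup [D] of unitary matrices, [A ^t*] is [A^-1]. *)
Lemma zdense_selfadjoint D G : sl_group G -> D `<=` G ->
  (forall A, D A -> A \is unitarymx) -> (forall A, D A -> D (invmx A)) ->
  zdense D G -> selfadjoint_group G.
Proof.
move=> sG DG uD DV dD; split=> // A GA; apply: (slg_zclosed sG) => f pf f0.
have := dD _ (polyfun_adj pf) _ A GA => H.
apply/eqP; rewrite -conjC_eq0; apply/eqP/H => B DB.
by rewrite -invmx_unitary ?uD // f0 ?rmorph0 //; exact/DG/DV.
Qed.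

(** Weyl's unitary trick with control on the conjugating element: it is the square root of an
    invariant form [Q] found inside [G], so it lies in [G] and conjugation by it preserves [G]. *)
Lemma unitarize G K : selfadjoint_group G -> K `<=` G -> compact_subgroup K ->
  exists2 g, G g & forall k, K k -> g *m k *m invmx g \is unitarymx.
Proof.
move=> saG KG [cK K1 KM KV]; have sG : sl_group G := saG.
have [Q [GQ pQ] fQ] := compact_fixed_point saG KG cK K1 KM KV.
have := mxpow_half pQ; have := mxpow_posdef 2^-1 pQ.
have := slg_mxpow 2^-1 sG GQ pQ; move: (mxpow Q 2^-1) => g Gg pg gg.
exists g => // k Kk; have ug := posdef_unit pg; have gh := posdef_herm pg.
rewrite -trmxC_unitary; apply/unitarymxP.
rewrite trmxCK !trmxC_mul trmxC_inv gh.
have -> : invmx g *m (k ^t* *m g) *m (g *m k *m invmx g) =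
    invmx g *m (k ^t* *m (g *m g) *m k) *m invmx g by rewrite !mulmxA.
by rewrite gg fQ // -gg (mulKmx ug) mulmxV.
Qed.

Lemma unitary_in_compact_subgroup G : sl_group G ->
  compact_subgroup (unitary_in G).
Proof.
move=> sG; split.
- apply: (@closed_bounded_compact _ _ _ _ _ 1).
    apply: closedI; first exact: zclosed_closed (slg_zclosed sG).
    exact: closed_unitarymx.
  by move=> A [_ uA] i j; rewrite rmorph1; exact: unitarymx_entry.
- by split; [exact: slg1|apply/unitarymxP; rewrite trmxC1 mulmx1].
- by move=> A B [GA uA] [GB uB]; split; [exact: slgM|exact: mul_unitarymx].
- move=> A [GA uA]; split; first exact: slgV.
  by rewrite invmx_unitary // trmxC_unitary.
Qed.

Lemma conj_set_self G g : sl_group G -> G g -> conj_set g G = G.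
Proof.
move=> sG Gg; have ug := slg_unit sG Gg; have GM := slgM sG; have GV := slgV sG.
apply/seteqP; split=> A GA.
  by rewrite -(conjKV A ug); apply: (GM) (GV _ Gg); exact: GM.
by apply: (GM) => //; apply: (GM) => //; exact: GV.
Qed.

Lemma conj_set_comp g h G : g \in unitmx -> h \in unitmx ->
  conj_set h (conj_set g G) = conj_set (h *m g) G.
Proof.
move=> ug uh; apply/seteqP; split=> A;
  by rewrite /conj_set /= (invmxM uh ug) !mulmxA.
Qed.


Lemma sl_group_unit G : sl_group G -> G `<=` [set A | A \in unitmx].
Proof. by move=> sG A; exact: slg_unit. Qed.

Lemma maximal_compact_retraction (p q : int) D G K :
  coprimez p q -> `|p|%N <> `|q|%N ->
  sl_group G -> compact_subgroup D -> D `<=` G -> zdense D G ->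
  compact_subgroup K -> K `<=` G ->
  (forall K', compact_subgroup K' -> K' `<=` G -> K `<=` K' -> K' = K) ->
  exists H : R * ('M[C]_n * 'M[C]_n) -> 'M[C]_n * 'M[C]_n,
    strong_deformation_retraction (bs_set p q G) (bs_set p q K) H.
Proof.
move=> pq pq' sG cD DG dD cK KG maxK.
have DSL : D `<=` [set A | \det A = 1] by move=> A /DG; exact: slg_det.
(* [G] itself is not yet known to be selfadjoint, so the dense subgroup [D] is made unitary inside
   the special linear group. *)
have [g0 /= dg0 ug0D] := unitarize (selfadjoint_SL C n) DSL cD.
have ug0 : g0 \in unitmx by rewrite unitmxE dg0 unitr1.
have sG1 : sl_group (conj_set g0 G) by exact: conj_set_slgroup.
have saG1 : selfadjoint_group (conj_set g0 G).
  apply: (zdense_selfadjoint sG1 _ _ _ (conj_set_zdense ug0 dD)).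
  - by move=> A DA; exact: DG DA.
  - by rewrite conj_set_image // => _ [A DA <-]; exact: ug0D.
  - have uD : D `<=` [set A | A \in unitmx] by move=> A /DG; exact: sl_group_unit.
    by case: (conj_set_subgroup ug0 uD cD).
have uK : K `<=` [set A | A \in unitmx] by move=> A /KG; exact: sl_group_unit.
have K1G : conj_set g0 K `<=` conj_set g0 G by move=> A; exact: KG.
(* The second conjugating element lies in the selfadjoint group obtained so far, so it makes the
   conjugate of [K] unitary without changing that group. *)
have [g1 Gg1 ug1K] := unitarize saG1 K1G (conj_set_subgroup ug0 uK cK).
have ug1 := slg_unit sG1 Gg1; pose h := g1 *m g0.
have uh : h \in unitmx by rewrite unitmx_mul ug1.
have GE : conj_set h G = conj_set g0 G by rewrite -conj_set_comp // conj_set_self.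
move: (conj_set g0 G) sG1 saG1 GE {K1G Gg1} => G1 sG1 saG1 GE.
have GhG A : G A -> G1 (h *m A *m invmx h) by move=> GA; rewrite -GE /conj_set /= conjK.
have ihu : invmx h \in unitmx by rewrite unitmx_inv.
have G1h A : G1 (h *m A *m invmx h) -> G A by rewrite -GE /conj_set /= conjK.
(* The unitary part of [G1], conjugated back, is a compact subgroup of [G] that contains [K];
   maximality makes it equal to [K]. *)
have KE : conj_set (invmx h) (unitary_in G1) = K.
  apply: maxK.
  - apply: conj_set_subgroup => //; last exact: unitary_in_compact_subgroup.
    by move=> A [_ /unitarymx_unit].
  - by move=> A []; rewrite invmxK => /G1h.
  - move=> A KA; rewrite /conj_set /= invmxK; split; first exact/GhG/KG.
    have -> : h *m A *m invmx h = g1 *m (g0 *m A *m invmx g0) *m invmx g1.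
      by rewrite /h invmxM // !mulmxA.
    by apply: ug1K; rewrite /conj_set /= conjK.
have [H sdrH] := bs_retraction pq pq' saG1.
pose f (w : 'M[C]_n * 'M[C]_n) := (invmx h *m w.1 *m h, invmx h *m w.2 *m h).
pose g (w : 'M[C]_n * 'M[C]_n) := (h *m w.1 *m invmx h, h *m w.2 *m invmx h).
have contc (a b : 'M[C]_n) : continuous (fun w : 'M[C]_n * 'M[C]_n =>
    (a *m w.1 *m b, a *m w.2 *m b)).
  move=> w; apply: (@cvg_pair2 _ _ _ (nbhs w)).
    apply: (@continuous_comp _ _ _ fst (fun A => a *m A *m b)).
      exact: cvg_fst.
    exact: conj_continuous.
  apply: (@continuous_comp _ _ _ snd (fun A => a *m A *m b)).
    exact: cvg_snd.
  exact: conj_continuous.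
have relE x y : y \in unitmx ->
    bs_rel p q (h *m x *m invmx h) (h *m y *m invmx h) <-> bs_rel p q x y.
  move=> uy; split; last exact: bs_rel_conj.
  have uhy : h *m y *m invmx h \in unitmx by rewrite unitmx_mul unitmx_mul uh uy.
  by move=> /(bs_rel_conj ihu uhy); rewrite invmxK !conjK.
exists (fun w => f (H (w.1, g w.2))).
apply: (@sdr_homeo _ _ _ f g _ _ _ _ H) sdrH.
- exact: contc.
- exact: contc.
- by move=> [x y]; rewrite /f /g /= !conjKV.
- by move=> [x y]; rewrite /f /g /= !conjK.
- move=> [x y]; split=> -[/= Gx Gy xy].
    split=> /=; [exact: GhG|exact: GhG|].
    by apply/relE => //; exact: slg_unit sG Gy.
  by split=> /=; [exact: G1h|exact: G1h|apply/relE => //; exact: slg_unit sG (G1h _ Gy)].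
- have KhE A : K A <-> unitary_in G1 (h *m A *m invmx h).
    by rewrite -{1}KE /conj_set /= invmxK.
  move=> [x y]; split=> -[/= Kx Ky xy].
    split=> /=; [exact/KhE|exact/KhE|].
    by apply/relE => //; exact: uK.
  by split=> /=; [exact/KhE|exact/KhE|apply/relE => //; apply: uK; exact/KhE].
Qed.

End Conjugation.

(** * Transfer to the concrete complex numbers *)

Section Complex.
Variable R : realType.

(** Closed by [Defined], so that its carrier unfolds to [Cplx R] and the abstract results apply to
    the given sets of matrices. *)
Definition complex_over : complexOver R.
Proof.
refine (@ComplexOver R (Cplx R) (fun t => (t%:C)%C) _ _ _ _).
- exact: (rmorphB (real_complex R)).
- exact: (conj (rmorph1 (real_complex R)) (rmorphM (real_complex R))).
- by move=> a b; exact: lecR.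
- by move=> z /complex_realP.
Defined.

Local Notation C := (Cplx R).

Lemma polyfun_peval n (f : mpoly.mpoly (n * n) C) :
  @polyfun R complex_over n (peval f).
Proof.
rewrite /peval; under eq_fun do rewrite mpoly.mevalE.
apply: (@polyfun_sum R complex_over) => m.
apply: (@polyfun_mul R complex_over); first exact: polyfun_const.
apply: (@polyfun_prod R complex_over) => k.
case/mxvec_indexP: k => i j; under eq_fun do rewrite mxvecE.
move: (mpoly.fun_of_multinom m _); elim=> [|d IHd].
  by under eq_fun do rewrite expr0; exact: (@polyfun_const R complex_over).
under eq_fun do rewrite exprS.
by apply: (@polyfun_mul R complex_over) => //; exact: polyfun_coord.
Qed.

Lemma peval_polyfun n (f : 'M[C]_n -> C) : @polyfun R complex_over n f ->
  exists F : mpoly.mpoly (n * n) C, forall A, f A = peval F A.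
Proof.
elim=> [c|i j|f1 f2 _ [F1 E1] _ [F2 E2]|f1 f2 _ [F1 E1] _ [F2 E2]].
- by exists (mpoly.mpolyC _ c) => A; rewrite /peval mpoly.mevalC.
- exists (mpoly.mpolyX _ (mpoly.mnm1 (mxvec_index i j))) => A.
  by rewrite /peval mpoly.mevalXU mxvecE.
- by exists (F1 + F2) => A; rewrite E1 E2 /peval mpoly.mevalD.
- by exists (F1 * F2) => A; rewrite E1 E2 /peval mpoly.mevalM.
Qed.

Lemma linear_algebraic_sl_group n (G : set 'M[C]_n) :
  linear_algebraic_group G -> @sl_group R complex_over n G.
Proof.
move=> [[uG G1 GM GV] [I GE]]; split=> //; first by rewrite GE => A [].
move=> A GA; rewrite GE; split.
  by apply: (@zclosed_SL R complex_over) => f pf f0; apply: GA => // B; rewrite {1}GE => -[dB _]; exact: f0.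
move=> f If; apply: GA; first exact: polyfun_peval.
by move=> B; rewrite GE => -[_]; exact.
Qed.

Lemma mxpowzE n (A : 'M[C]_n) z : mxpowz A z = mxz A z.
Proof. by case: z. Qed.

Lemma Hom_BS_bs_set (p q : int) n (G : set 'M[C]_n) : matrix_group G ->
  Hom_BS p q G = @bs_set R complex_over n p q G.
Proof.
move=> gG; rewrite (Hom_BSE gG); have [uG _ _ _] := gG.
apply/seteqP; split=> -[x y] [/= Gx Gy xy]; split=> //=; move: xy; rewrite /bs_rel !mxpowzE.
  by move=> <-; rewrite mulmxKV //; exact: uG.
by move=> ->; rewrite mulmxK //; exact: uG.
Qed.

Lemma compact_group_subgroup n (K : set 'M[C]_n) :
  compact_group K -> @compact_subgroup R complex_over n K.
Proof. by move=> [[_ K1 KM KV] cK]; split. Qed.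

End Complex.

Theorem theorem1p1 (R : realType) (p q : int) (n : nat)
    (G K : set 'M[Cplx R]_n)
    (pq_coprime : coprimez p q) (pq_abs : `|p|%N <> `|q|%N)
    (G_reductive : reductive G) (K_max : maximal_compact_subgroup G K) :
  (exists H, @strong_deformation_retraction R _ (Hom_BS p q G) (Hom_BS p q K) H)
  /\ homotopy_equivalent R (Hom_BS p q G) (Hom_BS p q K).
Proof.
have [algG [d [L [[[uL L1 LM LV] cL] [phi [[cphi LG] phiM dense _]]]]]] := G_reductive.
have [cK KG maxK] := K_max.
have sG := linear_algebraic_sl_group algG.
have uG A : G A -> A \in unitmx by case: algG => -[+ _ _ _] _; apply.
(* Only multiplicativity of [phi] on [L] is given; unit and inverses follow by cancelling in [G]. *)
have phi1 : phi 1%:M = 1%:M.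
  have := phiM 1%:M 1%:M L1 L1; rewrite mulmx1 => E.
  by rewrite -(mulKmx (uG _ (LG _ L1)) (phi 1%:M)) -E mulVmx // uG //; exact: LG.
have phiV x : L x -> phi (invmx x) = invmx (phi x).
  move=> Lx; have ux := uL _ Lx; have up := uG _ (LG _ Lx).
  have := phiM _ _ (LV _ Lx) Lx; rewrite mulVmx // phi1 => E.
  by rewrite -[LHS](mulmxK up) -E mul1mx.
have DG : phi @` L `<=` G by move=> _ [x Lx <-]; exact: LG.
have cD : @compact_subgroup R (complex_over R) n (phi @` L).
  split.
  - exact: continuous_compact.
  - by exists 1%:M.
  - by move=> _ _ [x Lx <-] [y Ly <-]; exists (x *m y); [exact: LM|exact: phiM].
  - by move=> _ [x Lx <-]; exists (invmx x); [exact: LV|exact: phiV].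
have dD : @zdense R (complex_over R) n (phi @` L) G.
  move=> f /peval_polyfun[F FE] f0 A GA; rewrite FE; apply: dense => // x Lx.
  by rewrite -FE; apply: f0; exists x.
have [] := @maximal_compact_retraction R (complex_over R) n p q _ G K pq_coprime
  pq_abs sG cD DG dD (compact_group_subgroup cK) KG.
  move=> K' [cK' K'1 K'M K'V] K'G; apply: maxK => //; split=> //.
  by split=> // A /K'G /uG.
move=> H; rewrite -Hom_BS_bs_set; last by case: algG.
rewrite -Hom_BS_bs_set; last by case: cK.
move=> sdrH; split; first by exists H.
exact: sdr_homotopy_equivalent sdrH.
Qed.
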